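(* For $q,r\ge 0$ let $N_{q,r}$ be the symplectic leaf of the hyper-Lie Poisson manifold $(\mathfrak{su}(2)^3_\star;\pi_1,\pi_2,\pi_3)$ defined in the context, with its induced hyperkähler structure and metric $g_{q,r}$. Call $N_{0,0}$ a leaf of type $0$, $N_{q,0}$ with $q>0$ a leaf of type $1$, and $N_{q,r}$ with $r>0$ (and $q\ge 0$) a leaf of type $2$. (a) Two leaves $N_{q,r}$ and $N_{q',r'}$ of different types are not isomorphic as hyperkähler manifolds. (b) For all $q,r\ge 0$ and all $t>0$, the map $$\rho_t\colon N_{q,r}\to N_{qt,rt},\qquad (a_1,a_2,a_3)\mapsto(\sqrt t\,a_1,\sqrt t\,a_2,\sqrt t\,a_3)$$ is a diffeomorphism which intertwines the three complex structures $I,J,K$ of $N_{q,r}$ with those of $N_{qt,rt}$ respectively, and satisfies $\rho_t^*(g_{qt,rt})=\sqrt t\cdot g_{q,r}$.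
   Context: $\langle\cdot,\cdot\rangle$ is the positive definite Ad-invariant inner product on $\mathfrak{su}(2)$ normalized so that $(\mathfrak{su}(2),[\cdot,\cdot],\langle\cdot,\cdot\rangle)\cong(\mathbb{R}^3,\times,\cdot)$, i.e. $\langle x,y\rangle=-2\operatorname{tr}(xy)$. Let $\Phi(a_1,a_2,a_3)=\langle a_1,[a_2,a_3]\rangle$ on $\mathfrak{su}(2)^3$ and $\mathfrak{su}(2)^3_\star=\{\Phi\neq0\}$. Hyper-Lie Poisson structure. For $\xi\in\mathfrak{su}(2)$ let $l^j_\xi(a_1,a_2,a_3)=\langle\xi,a_j\rangle$. On $\mathfrak{su}(2)^3_\star$ let $A_{\xi,\zeta}=\frac1\Phi\big(\langle[a_1,a_2],\xi\rangle\langle[a_1,a_2],\zeta\rangle+\langle[a_2,a_3],\xi\rangle\langle[a_2,a_3],\zeta\rangle+\langle[a_3,a_1],\xi\rangle\langle[a_3,a_1],\zeta\rangle\big)$. The bivector field $\pi_1$ is given by the brackets $\{l^1_\xi,l^1_\zeta\}=l^1_{[\xi,\zeta]}$, $\{l^1_\xi,l^2_\zeta\}=\{l^2_\xi,l^1_\zeta\}=l^2_{[\xi,\zeta]}$, $\{l^1_\xi,l^3_\zeta\}=\{l^3_\xi,l^1_\zeta\}=l^3_{[\xi,\zeta]}$, $\{l^2_\xi,l^2_\zeta\}=\{l^3_\xi,l^3_\zeta\}=-l^1_{[\xi,\zeta]}$, $\{l^2_\xi,l^3_\zeta\}=-\{l^3_\xi,l^2_\zeta\}=A_{\xi,\zeta}$.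 With $\sigma(a_1,a_2,a_3)=(a_3,a_1,a_2)$, put $\pi_2=\sigma_*\pi_1$, $\pi_3=\sigma_*\pi_2$. It is known (Xu) that $\pi_1,\pi_2,\pi_3$ are Poisson with the same symplectic leaves, and that on each leaf the induced symplectic forms $\omega_1,\omega_2,\omega_3$ (with $\omega_i^\flat$ the inverse of $\pi_i^\sharp$ along the leaf, where $\langle\omega^\flat(X),Y\rangle=\omega(X,Y)$ and $\langle\pi^\sharp(\alpha),\beta\rangle=\pi(\alpha,\beta)$) satisfy $[(\omega_i^\flat)^{-1}\omega_j^\flat]^2=-\mathrm{id}$ for $i\ne j$. The induced (pseudo-)metric is $g^\flat=\omega_3^\flat(\omega_1^\flat)^{-1}\omega_2^\flat$ and the complex structures are $I=(\omega_3^\flat)^{-1}\omega_2^\flat$, $J=(\omega_1^\flat)^{-1}\omega_3^\flat$, $K=(\omega_2^\flat)^{-1}\omega_1^\flat$. Explicitly, each leaf has the global frame $V_0=([a_2,a_3],[a_3,a_1],[a_1,a_2])$, $V_1=(0,[a_2,a_1],[a_3,a_1])$, $V_2=([a_1,a_2],0,[a_3,a_2])$, $V_3=([a_1,a_3],[a_2,a_3],0)$, with $g(V_i,V_j)=-\delta_{ij}\Phi$, $I(V_0,V_1,V_2,V_3)=(V_1,-V_0,V_3,-V_2)$, $J(V_0,V_1,V_2,V_3)=(V_2,-V_3,-V_0,V_1)$, $K(V_0,V_1,V_2,V_3)=(V_3,V_2,-V_1,-V_0)$. For $q,r\ge0$, $N_{q,r}$ is the leaf consisting of all $(a_1,a_2,a_3)\in\mathfrak{su}(2)^3$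 with $\langle a_i,a_j\rangle=0$ for $i\neq j$, $\langle a_1,a_1\rangle-\langle a_2,a_2\rangle=q$, $\langle a_2,a_2\rangle-\langle a_3,a_3\rangle=r$ and $\Phi<0$; there the metric $g_{q,r}$ is positive definite, so the structure is hyperkähler. An isomorphism of hyperkähler structures $(\tilde M,\tilde\omega_1,\tilde\omega_2,\tilde\omega_3)\to(M,\omega_1,\omega_2,\omega_3)$ is a diffeomorphism $F:\tilde M\to M$ with $F^*(\omega_1,\omega_2,\omega_3)=(\tilde\omega_1,\tilde\omega_2,\tilde\omega_3)O$ for some $O\in\mathrm{SO}(3)$ (row vector times matrix); in particular $F$ is an isometry. *)

(* Defs.v *)
From HB Require Import structures.
From mathcomp Require Import all_boot all_order all_algebra.
From mathcomp Require Import all_classical all_reals all_analysis.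
From mathcomp Require Import complex.
From mathcomp Require Import ring lra.
Set Implicit Arguments.
Unset Strict Implicit.
Unset Printing Implicit Defensive.
Import Order.TTheory GRing.Theory Num.Theory.
Import numFieldNormedType.Exports.
Local Open Scope classical_set_scope.
Local Open Scope ring_scope.

(* su(2) is carried by 'rV[R]_3 through its normalized identification with
   (R^3, cross product, dot product); su2_mx and the lemmas below relate
   this model to skew-Hermitian traceless 2 x 2 complex matrices. Index
   arithmetic such as k + 1 takes place in 'I_3, hence is modulo 3, and the
   indices 0, 1, 2 : 'I_3 stand for the subscripts 1, 2, 3 of the usual
   notation (a_1, pi_1, omega_1, and so on). *)
Section su2.
Context {R : realType}.
Implicit Types x y : 'rV[R]_3.

Definition lie x y : 'rV[R]_3 :=
  \row_k (x 0 (k + 1) * y 0 (k + 2) - x 0 (k + 2) * y 0 (k + 1)).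

Definition inner x y : R := \sum_k x 0 k * y 0 k.

(* \sum_k x_k e_k, where e_k is - i / 2 times the k-th Pauli matrix *)
Definition su2_mx x : 'M[R[i]]_2 := \matrix_(j, k)
  match val j, val k with
  | 0%N, 0%N => Complex 0 (- (x 0 2 / 2))
  | 0%N, _ => Complex (- (x 0 1 / 2)) (- (x 0 0 / 2))
  | _, 0%N => Complex (x 0 1 / 2) (- (x 0 0 / 2))
  | _, _ => Complex 0 (x 0 2 / 2)
  end.

Lemma su2_mx_linear (c : R) x y :
  su2_mx (c *: x + y) = real_complex R c *: su2_mx x + su2_mx y.
Proof.
apply/matrixP => j k; rewrite !mxE; apply/eqP; rewrite eq_complex.
by case: j k => [[|[|[]]] // ?] [[|[|[]]] // ?] /=;
  apply/andP; split; apply/eqP; rewrite ?mxE /=; field.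
Qed.

Lemma su2_mx_inj : injective su2_mx.
Proof.
move=> x y /matrixP xy.
have [e01i e00i] := (xy 0 0, xy 0 1).
move: e01i e00i; rewrite !mxE /= => -[z2] [z1 z0].
apply/rowP => -[[|[|[]]] // p].
- by rewrite (_ : Ordinal p = 0); [lra | exact: val_inj].
- by rewrite (_ : Ordinal p = 1); [lra | exact: val_inj].
- by rewrite (_ : Ordinal p = 2); [lra | exact: val_inj].
Qed.

Lemma su2_mx_range :
  range su2_mx = [set M | map_mx (@conjc R) M^T = - M /\ \tr M = 0].
Proof.
apply/seteqP; split => [_ [x _ <-]|M [/matrixP skewM trM]] /=.
  split.
    apply/matrixP => j k; rewrite !mxE; apply/eqP; rewrite eq_complex.
    by case: j k => [[|[|[]]] // ?] [[|[|[]]] // ?] /=;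
      apply/andP; split; apply/eqP; lra.
  rewrite /mxtrace !big_ord_recl big_ord0 !mxE /=.
  by apply/eqP; rewrite eq_complex /=; apply/andP; split; apply/eqP; lra.
move: trM (skewM 0 0) (skewM 0 1) (skewM 1 1).
rewrite /mxtrace !big_ord_recl big_ord0 !mxE.
rewrite (_ : lift ord0 ord0 = 1 :> 'I_2); last exact: val_inj.
rewrite (_ : ord0 = 0 :> 'I_2); last exact: val_inj.
case E00: (M 0 0) => [a b]; case E01: (M 0 1) => [c d].
case E10: (M 1 0) => [e f]; case E11: (M 1 1) => [g h].
move=> /eqP; rewrite eq_complex /= => /andP[/eqP t1 /eqP t2].
move=> /eqP; rewrite eq_complex /= => /andP[/eqP u1 /eqP u2].
move=> /eqP; rewrite eq_complex /= => /andP[/eqP v1 /eqP v2].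
move=> /eqP; rewrite eq_complex /= => /andP[/eqP w1 /eqP w2].
exists (\row_(k < 3) (if val k is 0%N then - 2 * d else
                     if val k is 1%N then - 2 * c else - 2 * b)); first by [].
apply/matrixP => j k; rewrite !mxE.
case: j k => [[|[|[]]] // p] [[|[|[]]] // q] /=.
- rewrite (_ : M _ _ = M 0 0); last by congr (M _ _); exact: val_inj.
  by rewrite E00; congr Complex; lra.
- rewrite (_ : M _ _ = M 0 1); last by congr (M _ _); exact: val_inj.
  by rewrite E01; congr Complex; lra.
- rewrite (_ : M _ _ = M 1 0); last by congr (M _ _); exact: val_inj.
  by rewrite E10; congr Complex; lra.
- rewrite (_ : M _ _ = M 1 1); last by congr (M _ _); exact: val_inj.
  by rewrite E11; congr Complex; lra.
Qed.

Let ord3E : (((0 + 1)%R = 1 :> 'I_3) * ((0 + 2)%R = 2 :> 'I_3) *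
  ((1 + 1)%R = 2 :> 'I_3) * ((1 + 2)%R = 0 :> 'I_3) *
  ((2 + 1)%R = 0 :> 'I_3) * ((2 + 2)%R = 1 :> 'I_3))%type.
Proof. by do !split; exact: val_inj. Qed.

Lemma su2_mx_lie x y :
  su2_mx (lie x y) = su2_mx x *m su2_mx y - su2_mx y *m su2_mx x.
Proof.
apply/matrixP => j k; rewrite !mxE !big_ord_recl !big_ord0 !mxE !ord3E.
by apply/eqP; rewrite eq_complex;
  case: j k => [[|[|[]]] // ?] [[|[|[]]] // ?] /=;
  apply/andP; split; apply/eqP; field.
Qed.

Lemma su2_mx_inner x y :
  real_complex R (inner x y) = - 2 * \tr (su2_mx x *m su2_mx y).
Proof.
rewrite /mxtrace !big_ord_recl big_ord0 !mxE !big_ord_recl !big_ord0 !mxE /=.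
rewrite /inner !big_ord_recl big_ord0.
rewrite (_ : lift ord0 (lift ord0 ord0) = 2 :> 'I_3); last exact: val_inj.
rewrite (_ : lift ord0 ord0 = 1 :> 'I_3); last exact: val_inj.
rewrite (_ : ord0 = 0 :> 'I_3); last exact: val_inj.
by apply/eqP; rewrite eq_complex /=; apply/andP; split; apply/eqP; field.
Qed.

End su2.

(* A point (a_1, a_2, a_3) of su(2)^3 is the matrix a : 'M[R]_3 with rows a_j.
   Tangent vectors are matrices as well, and so are covectors, a matrix alpha
   being identified with the linear form pairing alpha. *)
Section hyper_lie_poisson.
Context {R : realType}.
Implicit Types (a X Y alpha beta : 'M[R]_3) (xi zeta : 'rV[R]_3).
Implicit Types i j k : 'I_3.

Definition pairing alpha X : R := \sum_j inner (row j alpha) (row j X).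

Definition Phi a : R := inner (row 0 a) (lie (row 1 a) (row 2 a)).

(* the differential at any point of the linear function X |-> pairing alpha (L X) *)
Definition pullback_covector (L : 'M[R]_3 -> 'M[R]_3) alpha : 'M[R]_3 :=
  \matrix_(j, k) pairing alpha (L (delta_mx j k)).

(* A bivector field, given at each point by its values on pairs of covectors. *)
Definition bivector_field := 'M[R]_3 -> 'M[R]_3 -> 'M[R]_3 -> R.

Definition Afun a xi zeta : R :=
  (Phi a)^-1 *
  (inner (lie (row 0 a) (row 1 a)) xi * inner (lie (row 0 a) (row 1 a)) zeta +
   inner (lie (row 1 a) (row 2 a)) xi * inner (lie (row 1 a) (row 2 a)) zeta +
   inner (lie (row 2 a) (row 0 a)) xi * inner (lie (row 2 a) (row 0 a)) zeta).

(* the bracket {l^j_xi, l^k_zeta} at a, where l^j_xi(a) = <xi, a_j> *)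
Definition bracket1 a j k xi zeta : R :=
  match val j, val k with
  | 0%N, 0%N => inner (lie xi zeta) (row 0 a)
  | 0%N, 1%N | 1%N, 0%N => inner (lie xi zeta) (row 1 a)
  | 0%N, _ | _, 0%N => inner (lie xi zeta) (row 2 a)
  | 1%N, 1%N => - inner (lie xi zeta) (row 0 a)
  | 1%N, _ => Afun a xi zeta
  | _, 1%N => - Afun a xi zeta
  | _, _ => - inner (lie xi zeta) (row 0 a)
  end.

Definition pi1 : bivector_field := fun a alpha beta =>
  \sum_j \sum_k bracket1 a j k (row j alpha) (row k beta).

(* sigma (a_1, a_2, a_3) = (a_3, a_1, a_2) *)
Definition sigma a : 'M[R]_3 := \matrix_(j, k) a (j - 1) k.
Definition sigma_inv a : 'M[R]_3 := \matrix_(j, k) a (j + 1) k.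

(* sigma is linear, hence equal to its own differential *)
Definition sigma_push (P : bivector_field) : bivector_field :=
  fun a alpha beta => P (sigma_inv a)
    (pullback_covector sigma alpha) (pullback_covector sigma beta).

Definition poisson i : bivector_field := iter i sigma_push pi1.

(* pi_i^sharp; <pi^sharp(alpha), beta> = pi(alpha, beta) *)
Definition sharp i a alpha : 'M[R]_3 :=
  \matrix_(j, k) poisson i a alpha (delta_mx j k).

(* The tangent space at a of the symplectic leaf through a; the three Poisson
   structures have the same leaves. *)
Definition leaf_tangent a : set 'M[R]_3 := range (sharp 0 a).

(* For X tangent to the leaf, flat i a X is a covector restricting to
   omega_i^flat (X), the preimage of X under pi_i^sharp. It is determined up to
   covectors vanishing on the leaf, and only its restriction to the leaf is
   meaningful. *)
Definition flat i a X : 'M[R]_3 := xget 0 [set alpha | sharp i a alpha = X].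

Definition omega i a X Y : R := pairing (flat i a X) Y.

Definition metric a X Y : R := pairing (flat 2 a (sharp 0 a (flat 1 a X))) Y.

Definition cplxI a X : 'M[R]_3 := sharp 2 a (flat 1 a X).
Definition cplxJ a X : 'M[R]_3 := sharp 0 a (flat 2 a X).
Definition cplxK a X : 'M[R]_3 := sharp 1 a (flat 0 a X).

(* N_{q,r} *)
Definition leaf (q r : R) : set 'M[R]_3 := [set a |
  [/\ forall i j, i != j -> inner (row i a) (row j a) = 0,
      inner (row 0 a) (row 0 a) - inner (row 1 a) (row 1 a) = q,
      inner (row 1 a) (row 1 a) - inner (row 2 a) (row 2 a) = r
    & Phi a < 0]].

Definition leaf_type (q r : R) : nat :=
  if 0 < r then 2%N else if 0 < q then 1%N else 0%N.

Definition rho (t : R) a : 'M[R]_3 := Num.sqrt t *: a.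

End hyper_lie_poisson.

Section smooth_maps.
Context {R : realType}.

Fixpoint Ck {V W : normedModType R} (n : nat) (U : set V) (f : V -> W) : Prop :=
  if n is m.+1 then
    (forall x, U x -> differentiable f x) /\
    (forall v, Ck m U (fun x => 'd f x v))
  else forall x, U x -> {for x, continuous f}.

Definition smooth {V W : normedModType R} (U : set V) (f : V -> W) : Prop :=
  forall n, Ck n U f.

Implicit Types (N : set 'M[R]_3) (F : 'M[R]_3 -> 'M[R]_3).

(* G is a smooth extension of F restricted to N to a neighbourhood of a *)
Definition local_extension N F (a : 'M[R]_3) (G : 'M[R]_3 -> 'M[R]_3) : Prop :=
  exists U : set 'M[R]_3,
    [/\ open U, U a, smooth U G & forall x, N x -> U x -> G x = F x].

(* Smoothness of a map on the embedded submanifold N. *)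
Definition smooth_on N F : Prop :=
  forall a, N a -> exists G, local_extension N F a G.

(* Only the values of F and G on N and N' matter. *)
Definition diffeomorphism N N' F : Prop :=
  exists G : 'M[R]_3 -> 'M[R]_3,
    [/\ smooth_on N F, smooth_on N' G,
        forall a, N a -> N' (F a) /\ G (F a) = a
      & forall b, N' b -> N (G b) /\ F (G b) = b].

(* The tangent map of F : N -> N' at a, computed from a local extension; on
   vectors tangent to N it does not depend on the extension. *)
Definition tangent_map N F (a X : 'M[R]_3) : 'M[R]_3 :=
  'd (xget F [set G | local_extension N F a G]) a X.

End smooth_maps.

Section hyperkahler_isomorphisms.
Context {R : realType}.
Implicit Types (N : set 'M[R]_3) (F : 'M[R]_3 -> 'M[R]_3).

Definition SO3 : set 'M[R]_3 := [set O | O *m O^T = 1%:M /\ \det O = 1].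

(* For leaves N, N' : F^*(omega_1, omega_2, omega_3) =
   (omega_1, omega_2, omega_3) O as row vectors of 2-forms on N. *)
Definition hyperkahler_isomorphism N N' F : Prop :=
  diffeomorphism N N' F /\
  exists2 O, SO3 O & forall a X Y (i : 'I_3),
    N a -> leaf_tangent a X -> leaf_tangent a Y ->
    omega i (F a) (tangent_map N F a X) (tangent_map N F a Y) =
    \sum_j omega j a X Y * O j i.

Definition hyperkahler_isomorphic N N' : Prop :=
  exists F, hyperkahler_isomorphism N N' F.

Definition intertwines N F (C : 'M[R]_3 -> 'M[R]_3 -> 'M[R]_3) : Prop :=
  forall a X, N a -> leaf_tangent a X ->
    tangent_map N F a (C a X) = C (F a) (tangent_map N F a X).

Definition pullback_metric_scaled N F (c : R) : Prop :=
  forall a X Y, N a -> leaf_tangent a X -> leaf_tangent a Y ->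
    metric (F a) (tangent_map N F a X) (tangent_map N F a Y) = c * metric a X Y.

End hyperkahler_isomorphisms.

(* Main.v *)
Require Import Defs.
From HB Require Import structures.
From mathcomp Require Import all_boot all_order all_algebra.
From mathcomp Require Import all_classical all_reals all_analysis.
From mathcomp Require Import ring lra.
Set Implicit Arguments.
Unset Strict Implicit.
Unset Printing Implicit Defensive.
Import Order.TTheory GRing.Theory Num.Theory.
Import numFieldNormedType.Exports.
Local Open Scope classical_set_scope.
Local Open Scope ring_scope.

(** The rows of the cofactor matrix cof a are [a_2,a_3], [a_3,a_1], [a_1,a_2], so
    cof a is the vector V_0 and V_k = E_k V_0 with constant matrices E_k that,
    with the identity, span the matrices kappa + [k], where [k] is the cross
    product by k. For every a with Phi a <> 0 the three Poisson tensors are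
    1/Phi times constant quaternionic forms on the four numbers <alpha, V_k>
    (poissonE); this polynomial identity gives the tangent spaces, the forms
    omega_i = - Phi <c, C_i d>, the metric - Phi <c, d> and the complex structures
    in the frame V_k. Since V_k is quadratic in a and Phi cubic, the statement
    on the dilations rho_t follows by counting degrees.

    To tell the types apart, only first derivatives of an isomorphism are used.
    If F^* omega = omega O with O in SO(3), then T C_i T^t is up to a factor a
    rotated quaternion triple, and multiplying the three of them gives T T^t: F
    is an isometry (conformal_of_triple, hyperkahler_isometry). Call a function
    short when it is 1-Lipschitz along curves of the leaf. Short functions define
    the distance, and the leaves are incomplete: points run out of the leaf at
    finite distance as |a_3| tends to 0. A leaf is M-wide when it contains two
    points, both at distance at most rho from the missing boundary, at distance
    at least M rho from each other (wide). This is invariant under isomorphisms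
    (wide_isomorphic). The three types differ in the shape of the boundary.

    - Type 0 is the flat cone of nonzero quaternions up to sign, with the apex
      missing. A segment between two points at distance at most rho from the apex
      and forming at most a right angle has length at most sqrt 2 rho, and the sign
      of one of them can be chosen so; hence the leaf is not 3/2-wide (line_bound,
      not_wide_type0).
    - In type 1 the boundary is a 2-sphere, the directions of a_1; the leaf is
      M-wide for all M because the direction of a_1 is Lipschitz (short_axis,
      wide_type1).
    - In type 2 the orbits collapse to a point, since the turns about the first
      two axes become arbitrarily short and generate SO(3); by the triangle
      inequality the leaf is not 3-wide (not_wide_type2). However the turn about
      the third axis becomes arbitrarily long, and so close to the boundary the
      shortest way between opposite directions of a_1 runs almost through the
      boundary; the leaf is 3/2-wide (short_spike, wide_type2). *)

(** * Small index types *)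

Lemma sum3E (V : nmodType) (F : 'I_3 -> V) : \sum_j F j = F 0 + F 1 + F 2.
Proof.
rewrite !big_ord_recl big_ord0 addr0 addrA.
by congr (_ + _ + _); congr F; exact: val_inj.
Qed.

Lemma sum4E (V : nmodType) (F : 'I_4 -> V) :
  \sum_j F j = F 0 + F 1 + F 2 + F 3.
Proof.
rewrite !big_ord_recl big_ord0 addr0 !addrA.
by congr (_ + _ + _ + _); congr F; exact: val_inj.
Qed.

Lemma all3P (P : 'I_3 -> Prop) : P 0 -> P 1 -> P 2 -> forall j, P j.
Proof.
move=> P0 P1 P2 [[|[|[|//]]] lt_j].
- by rewrite (_ : Ordinal _ = 0) //; exact: val_inj.
- by rewrite (_ : Ordinal _ = 1) //; exact: val_inj.
- by rewrite (_ : Ordinal _ = 2) //; exact: val_inj.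
Qed.

Lemma all4P (P : 'I_4 -> Prop) : P 0 -> P 1 -> P 2 -> P 3 -> forall j, P j.
Proof.
move=> P0 P1 P2 P3 [[|[|[|[|//]]]] lt_j].
- by rewrite (_ : Ordinal _ = 0) //; exact: val_inj.
- by rewrite (_ : Ordinal _ = 1) //; exact: val_inj.
- by rewrite (_ : Ordinal _ = 2) //; exact: val_inj.
- by rewrite (_ : Ordinal _ = 3) //; exact: val_inj.
Qed.

Lemma ord3E : (((0 + 1)%R = 1 :> 'I_3) * ((0 + 2)%R = 2 :> 'I_3) *
  ((1 + 1)%R = 2 :> 'I_3) * ((1 + 2)%R = 0 :> 'I_3) *
  ((2 + 1)%R = 0 :> 'I_3) * ((2 + 2)%R = 1 :> 'I_3))%type.
Proof. by do !split; exact: val_inj. Qed.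

Section leaf_isometries.
Context {R : realType}.
Implicit Types (a X Y alpha beta g : 'M[R]_3) (c d : 'rV[R]_4).

(** * The Poisson structures in the quaternionic frame *)

Definition mx3 (x00 x01 x02 x10 x11 x12 x20 x21 x22 : R) : 'M[R]_3 :=
  \matrix_(j, k) nth 0 (nth [::]
    [:: [:: x00; x01; x02]; [:: x10; x11; x12]; [:: x20; x21; x22]] j) k.

(** The cofactor matrix of a, which is also the tangent vector V_0. *)
Definition cof a : 'M[R]_3 :=
  \matrix_(j, k) lie (row (j + 1) a) (row (j + 2) a) 0 k.

(** The matrix c_0 + [(c_1,c_2,c_3)], where [v] is the matrix of the cross
    product by v. *)
Definition quat3 c : 'M[R]_3 :=
  mx3 (c 0 0) (- c 0 3) (c 0 2)
      (c 0 3) (c 0 0) (- c 0 1)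
      (- c 0 2) (c 0 1) (c 0 0).

(** The tangent vector with coordinates c in the frame V_0, V_1, V_2, V_3. *)
Definition frame a c : 'M[R]_3 := quat3 c *m cof a.

(** Quaternions s + v as matrices acting on rows; the order of products is reversed,
    hence the sign of lie in qmxM. *)
Definition qmx (s : R) (v : 'rV[R]_3) : 'M[R]_4 :=
  \matrix_(j, k) nth 0 (nth [::]
    [:: [:: s; v 0 0; v 0 1; v 0 2];
        [:: - v 0 0; s; v 0 2; - v 0 1];
        [:: - v 0 1; - v 0 2; s; v 0 0];
        [:: - v 0 2; v 0 1; - v 0 0; s]] j) k.

Definition Cmx (i : 'I_3) : 'M[R]_4 := qmx 0 (delta_mx 0 i).

Lemma qmxM (s t : R) v w :
  qmx s v *m qmx t w = qmx (s * t - inner v w) (s *: w + t *: v - lie v w).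
Proof.
apply/matrixP; do 2 (apply: all4P); rewrite !mxE !sum4E !mxE /= /inner ?sum3E
  ?mxE ?ord3E /=; by ring.
Qed.

(** The restriction of the covector alpha to the leaf, in the frame dual to V_k. *)
Definition coef a alpha : 'rV[R]_4 := \row_k pairing alpha (frame a (delta_mx 0 k)).

Lemma PhiE a : Phi a = a 0 0 * (a 1 1 * a 2 2 - a 1 2 * a 2 1)
  + a 0 1 * (a 1 2 * a 2 0 - a 1 0 * a 2 2)
  + a 0 2 * (a 1 0 * a 2 1 - a 1 1 * a 2 0).
Proof. by rewrite /Phi /inner sum3E !mxE !ord3E. Qed.

Lemma mul_cof_tr a : cof a *m a^T = (Phi a)%:M.
Proof.
rewrite PhiE; apply/matrixP; do 2 apply: all3P;
  rewrite !mxE sum3E !mxE !ord3E /= ?mulr1n ?mulr0n; ring.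
Qed.

(** The cross product of two rows of cof a is Phi a times a row of a; this trades
    the linear brackets of pi_1 for products of values of the covectors on cof a. *)
Lemma inner_lie_row a xi zeta j :
  Phi a * inner (lie xi zeta) (row j a) =
  inner xi (row (j + 1) (cof a)) * inner zeta (row (j + 2) (cof a)) -
  inner xi (row (j + 2) (cof a)) * inner zeta (row (j + 1) (cof a)).
Proof.
rewrite PhiE /inner !sum3E !mxE; move: j; apply: all3P; rewrite !ord3E; ring.
Qed.

Lemma innerC (x y : 'rV[R]_3) : inner x y = inner y x.
Proof. by apply: eq_bigr => k _; rewrite mulrC. Qed.

Lemma lieC (x y : 'rV[R]_3) : lie x y = - lie y x.
Proof. by apply/rowP => k; rewrite !mxE; ring. Qed.

Lemma row_cof a j : row j (cof a) = lie (row (j + 1) a) (row (j + 2) a).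
Proof. by apply/rowP => k; rewrite !mxE. Qed.

Lemma inner_row_mul (x : 'rV[R]_3) (Q B : 'M[R]_3) j :
  inner x (row j (Q *m B)) = \sum_k Q j k * inner x (row k B).
Proof.
rewrite /inner; under [RHS]eq_bigr => k _ do rewrite mulr_sumr.
rewrite exchange_big; apply: eq_bigr => l _.
by rewrite !mxE mulr_sumr; apply: eq_bigr => k _; rewrite !mxE mulrCA.
Qed.

Lemma coefE a alpha (P := fun j k => inner (row j alpha) (row k (cof a))) :
  coef a alpha = \row_k nth 0 [:: P 0 0 + P 1 1 + P 2 2; P 2 1 - P 1 2;
                                  P 0 2 - P 2 0; P 1 0 - P 0 1] k.
Proof.
apply/rowP => k; rewrite [LHS]mxE /pairing sum3E !inner_row_mul !sum3E -!/(P _ _).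
move: P k => P; apply: all4P; rewrite !mxE /= ?mxE /=; ring.
Qed.

(** In terms of the numbers <alpha_j, row k of cof a> the function A is already
    quadratic, and inner_lie_row makes the linear brackets quadratic too; they
    assemble to (V_0 wedge V_1 + V_2 wedge V_3) / Phi. *)
Lemma pi1E a alpha beta : Phi a != 0 ->
  pi1 a alpha beta =
   (Phi a)^-1 * (coef a alpha *m Cmx 0 *m (coef a beta)^T) 0 0.
Proof.
move=> Phi0; apply: (mulfI Phi0); rewrite mulrA mulfV // mul1r.
rewrite /pi1 !sum3E /bracket1 /= /Afun.
have PhiV y : Phi a * ((Phi a)^-1 * y) = y by rewrite mulrA mulfV // mul1r.
rewrite ![Phi a * (_ + _)]mulrDr ![Phi a * - _]mulrN !PhiV !inner_lie_row !ord3E.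
rewrite !coefE !mxE !sum4E !mxE !sum4E !mxE /=.
have e01 xi : inner (lie (row 0 a) (row 1 a)) xi =
    inner xi (row 2 (cof a)).
  by rewrite innerC row_cof !ord3E.
have e12 xi : inner (lie (row 1 a) (row 2 a)) xi =
    inner xi (row 0 (cof a)).
  by rewrite innerC row_cof !ord3E.
have e20 xi : inner (lie (row 2 a) (row 0 a)) xi =
    inner xi (row 1 (cof a)).
  by rewrite innerC row_cof !ord3E.
rewrite !e01 !e12 !e20; ring.
Qed.

(** sigma is orthogonal, so its transpose is its inverse. *)
Lemma sigma_pushE (P : bivector_field) a alpha beta :
  sigma_push P a alpha beta =
  P (sigma_inv a) (sigma_inv alpha) (sigma_inv beta).
Proof.
have pullE gamma : pullback_covector sigma gamma = sigma_inv gamma.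
  apply/matrixP => j k; rewrite !mxE /pairing (bigD1 (j + 1)) //=.
  rewrite [X in _ + X]big1 ?addr0 => [|i ne_i]; last first.
    rewrite /inner big1 // => l _; rewrite !mxE.
    by rewrite subr_eq (negPf ne_i) mulr0.
  rewrite /inner (bigD1 k) //= !mxE addrK !eqxx mulr1 big1 ?addr0 // => l ne_l.
  by rewrite !mxE (negPf ne_l) andbF mulr0.
by rewrite /sigma_push !pullE.
Qed.

Lemma row_sigma_inv a j : row j (sigma_inv a) = row (j + 1) a.
Proof. by apply/rowP => k; rewrite !mxE. Qed.

Lemma cof_sigma_inv a : cof (sigma_inv a) = sigma_inv (cof a).
Proof.
by apply/row_matrixP => j;
  rewrite row_sigma_inv !row_cof !row_sigma_inv [j + 2 + 1]addrAC.
Qed.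

Lemma Phi_sigma_inv a : Phi (sigma_inv a) = Phi a.
Proof. by rewrite !PhiE !mxE !ord3E; ring. Qed.

(** The shift of the rows fixes V_0 and permutes V_1, V_2, V_3 cyclically; this
    carries the formula for pi_1 to pi_2 and pi_3. *)
Lemma coef_sigma_inv a alpha (c := coef a alpha) :
  coef (sigma_inv a) (sigma_inv alpha) =
  \row_k nth 0 [:: c 0 0; c 0 2; c 0 3; c 0 1] k.
Proof.
rewrite /c !coefE cof_sigma_inv !row_sigma_inv !ord3E.
apply/rowP; apply: all4P; rewrite !mxE /=; ring.
Qed.

Lemma poissonE i a alpha beta : Phi a != 0 ->
  poisson i a alpha beta =
   (Phi a)^-1 * (coef a alpha *m Cmx i *m (coef a beta)^T) 0 0.
Proof.
move: i; apply: all3P => Phi0; rewrite /poisson /= ?sigma_pushE pi1E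
   ?Phi_sigma_inv // ?coef_sigma_inv; congr (_ * _).
  by move: (coef a alpha) (coef a beta) => c d;
    rewrite !mxE !sum4E !mxE !sum4E !mxE /=; ring.
by move: (coef a alpha) (coef a beta) => c d;
  rewrite !mxE !sum4E !mxE !sum4E !mxE /=; ring.
Qed.

Lemma mx11_tr (M : 'M[R]_1) : M^T 0 0 = M 0 0.
Proof. by rewrite mxE. Qed.

Lemma pairing_delta j k X : pairing (delta_mx j k) X = X j k.
Proof.
rewrite /pairing (bigD1 j) //= [X in _ + X]big1 ?addr0 => [|i ne_i]; last first.
  by rewrite /inner big1 // => l _; rewrite !mxE (negPf ne_i) mul0r.
rewrite /inner (bigD1 k) //= !mxE !eqxx mul1r big1 ?addr0 // => l ne_l.
by rewrite !mxE (negPf ne_l) andbF mul0r.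
Qed.

Lemma pairing_frame a alpha c :
  pairing alpha (frame a c) = (coef a alpha *m c^T) 0 0.
Proof.
rewrite /frame coefE /pairing sum3E !inner_row_mul !sum3E !mxE sum4E !mxE /=.
ring.
Qed.

Lemma sharpE i a alpha : Phi a != 0 ->
  sharp i a alpha = frame a ((Phi a)^-1 *: (coef a alpha *m Cmx i)).
Proof.
move=> Phi0; apply/matrixP => j k.
rewrite -[RHS]pairing_delta pairing_frame mxE poissonE //.
by rewrite -[in RHS]mx11_tr trmx_mul trmxK -scalemxAl [in RHS]mxE.
Qed.

(** cof a is Phi a times the inverse transpose of a, so multiplying by the
    transpose of a reads off the coordinates of a tangent vector. *)
Lemma frame_mul_tr a c : frame a c *m a^T = Phi a *: quat3 c.
Proof. by rewrite -mulmxA mul_cof_tr mul_mx_scalar. Qed.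

Lemma quat3_inj : injective quat3.
Proof.
move=> c d /matrixP E; apply/rowP; apply: all4P.
- by have := E 0 0; rewrite !mxE.
- by have := E 2 1; rewrite !mxE.
- by have := E 0 2; rewrite !mxE.
- by have := E 1 0; rewrite !mxE.
Qed.

Lemma frame_inj a : Phi a != 0 -> injective (frame a).
Proof.
move=> Phi0 c d cd; apply: quat3_inj; apply: (scalerI Phi0).
by rewrite -!frame_mul_tr cd.
Qed.

Lemma coef_surj a c : Phi a != 0 -> exists alpha, coef a alpha = c.
Proof.
move=> Phi0.
(* M pairs with the identity as its trace and with each [e_k] as twice an entry. *)
pose M := mx3 (c 0 0 / 3) (- c 0 3 / 2) (c 0 2 / 2)
      (c 0 3 / 2) (c 0 0 / 3) (- c 0 1 / 2)
      (- c 0 2 / 2) (c 0 1 / 2) (c 0 0 / 3).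
exists ((Phi a)^-1 *: (M *m a)); set alpha := _ *: _.
have aM : alpha *m (cof a)^T = M.
  rewrite -scalemxAl -mulmxA -[a]trmxK -trmx_mul trmxK mul_cof_tr tr_scalar_mx.
  by rewrite mul_mx_scalar scalerA mulVf // scale1r.
have PE j k : inner (row j alpha) (row k (cof a)) = M j k.
  by rewrite -aM mxE; apply: eq_bigr => l _; rewrite !mxE.
rewrite coefE; apply/rowP; apply: all4P; rewrite !mxE /= !PE !mxE /=; by field.
Qed.

Lemma qmx_scalar s : qmx s 0 = s%:M.
Proof.
apply/matrixP; do 2 apply: all4P; rewrite !mxE /= ?mulr1n ?mulr0n ?oppr0 //.
Qed.

Lemma lie_self (x : 'rV[R]_3) : lie x x = 0.
Proof. by apply/rowP => k; rewrite !mxE; ring. Qed.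

Lemma inner_delta (i j : 'I_3) :
  inner (delta_mx 0 i) (delta_mx 0 j : 'rV[R]_3) = (i == j)%:R.
Proof.
rewrite /inner (bigD1 i) //= !mxE !eqxx mul1r big1 ?addr0 //= => k ne_k.
by rewrite !mxE (negPf ne_k) mul0r.
Qed.

Lemma CmxK i : Cmx i *m Cmx i = - 1%:M.
Proof.
by rewrite qmxM lie_self !scale0r !addr0 subr0 mul0r sub0r inner_delta eqxx
  qmx_scalar raddfN.
Qed.

(** flat is a choice of preimage under sharp; coef is what does not depend on the
    choice, because C_i is invertible. *)
Lemma coef_flat i a c : Phi a != 0 ->
  coef a (flat i a (frame a c)) = - Phi a *: (c *m Cmx i).
Proof.
move=> Phi0; have [alpha0 alpha0E] := coef_surj (- Phi a *: (c *m Cmx i)) Phi0.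
have : sharp i a (flat i a (frame a c)) = frame a c.
  apply: (@xgetPex _ 0 [set alpha | sharp i a alpha = frame a c]).
  exists alpha0 => /=; rewrite sharpE // alpha0E -scalemxAl -mulmxA CmxK.
  by rewrite mulmxN mulmx1 scalerA mulrN mulVf // scaleN1r opprK.
rewrite sharpE // => /(frame_inj Phi0) E.
rewrite -[in RHS]E -!scalemxAl -mulmxA CmxK scalerA mulrC mulrN mulVf //.
by rewrite scaleN1r mulmxN mulmx1 opprK.
Qed.

Lemma omegaE i a c d : Phi a != 0 ->
  omega i a (frame a c) (frame a d) = - Phi a * (c *m Cmx i *m d^T) 0 0.
Proof. by move=> Phi0; rewrite /omega pairing_frame coef_flat // -scalemxAl mxE. Qed.

Lemma leaf_tangentP a X : Phi a != 0 ->
  leaf_tangent a X <-> exists c, X = frame a c.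
Proof.
move=> Phi0; split=> [[alpha _ <-]|[c ->]].
  by rewrite sharpE //; eexists.
have [alpha alphaE] := coef_surj (- Phi a *: (c *m Cmx 0)) Phi0.
exists alpha => //; rewrite sharpE // alphaE -scalemxAl -mulmxA CmxK.
by rewrite mulmxN mulmx1 scalerA mulrN mulVf // scaleN1r opprK.
Qed.

Lemma sharp_flatE i j a c : Phi a != 0 ->
  sharp i a (flat j a (frame a c)) = frame a (- (c *m Cmx j *m Cmx i)).
Proof.
move=> Phi0; rewrite sharpE // coef_flat // -scalemxAl scalerA mulrN mulVf //.
by rewrite scaleN1r.
Qed.

Lemma Cmx_prod : Cmx 1 *m Cmx 0 *m Cmx 2 = - 1%:M.
Proof.
rewrite !qmxM !inner_delta /= !scale0r !mul0r !addr0 subr0 sub0r.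
transitivity (qmx (-1) 0); last by rewrite qmx_scalar raddfN.
congr qmx.
  rewrite /inner sum3E !mxE ?ord3E /=; by ring.
by apply/rowP; apply: all3P; rewrite !mxE ?ord3E /=; ring.
Qed.

Lemma metricE a c d : Phi a != 0 ->
  metric a (frame a c) (frame a d) = - Phi a * (c *m d^T) 0 0.
Proof.
move=> Phi0; rewrite /metric sharp_flatE // pairing_frame coef_flat // mulNmx.
have -> : c *m Cmx 1 *m Cmx 0 *m Cmx 2 = - c.
  by rewrite -[LHS]mulmxA -[LHS]mulmxA [X in c *m X]mulmxA Cmx_prod mulmxN mulmx1.
by rewrite opprK -scalemxAl mxE.
Qed.

(** * Derivatives along curves *)

Lemma der_mxP (c : R -> 'M[R]_3) t X :
  is_derive t (1 : R) c X <-> forall i j, is_derive t (1 : R) (fun u =>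
    c u i j) (X i j).
Proof.
split=> [[dc <-] i j|dc].
  by rewrite derive_mx // mxE; apply: derivableP; exact: (derivable_mxP _ _ _).1.
have dc' : derivable c t 1 by apply/derivable_mxP => i j; exact: (dc i j).(ex_derive).
apply: DeriveDef => //; rewrite derive_mx //; apply/matrixP => i j.
by rewrite mxE; exact: (dc i j).(derive_val).
Qed.

Lemma derD (f g : R -> R) (t df dg : R) : is_derive t (1 : R) f df ->
  is_derive t (1 : R) g dg ->
  is_derive t (1 : R) (fun u => f u + g u) (df + dg).
Proof. exact: is_deriveD. Qed.

Lemma derN (f : R -> R) (t df : R) : is_derive t (1 : R) f df ->
  is_derive t (1 : R) (fun u => - f u) (- df).
Proof. exact: is_deriveN. Qed.

Lemma derM (f g : R -> R) (t df dg : R) : is_derive t (1 : R) f df ->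
  is_derive t (1 : R) g dg ->
  is_derive t (1 : R) (fun u => f u * g u) (df * g t + f t * dg).
Proof.
move=> hf hg; apply: (is_derive_eq (is_deriveM hf hg)).
by rewrite addrC; congr (_ + _); exact: mulrC.
Qed.

Lemma der_cst (k t : R) : is_derive t (1 : R) (fun=> k) 0.
Proof. exact: is_derive_cst. Qed.

Lemma der_sqrt (f : R -> R) (t df : R) : is_derive t (1 : R) f df -> 0 < f t ->
  is_derive t (1 : R) (fun u => Num.sqrt (f u)) (df / (2 * Num.sqrt (f t))).
Proof.
by move=> hf f0; rewrite mulrC; apply: is_derive1_comp; exact: is_derive1_sqrt.
Qed.

Lemma derV (f : R -> R) (t df : R) : is_derive t (1 : R) f df -> f t != 0 ->
  is_derive t (1 : R) (fun u => (f u)^-1) (- (df / f t ^+ 2)).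
Proof.
move=> [hf <-] f0; apply: DeriveDef; first exact: derivableV.
by rewrite deriveV // /GRing.scale /= mulNr mulrC.
Qed.

Lemma der_eq (f : R -> R) (t df df' : R) : is_derive t (1 : R) f df -> df = df' ->
  is_derive t (1 : R) f df'.
Proof. by move=> ? <-. Qed.

Lemma der_uniq (W : normedModType R) (f : R -> W) (t : R) (x y : W) :
  is_derive t (1 : R) f x -> is_derive t (1 : R) f y -> x = y.
Proof. by move=> [_ <-] [_ <-]. Qed.

Lemma der_mulmx2 (A B : 'M[R]_3) (c : R -> 'M[R]_3) t X : is_derive t (1 : R) c X ->
  is_derive t (1 : R) (fun u => A *m c u *m B) (A *m X *m B).
Proof.
move=> /der_mxP dc; apply/der_mxP => i j.
have E (Z : 'M[R]_3) : (A *m Z *m B) i j =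
   \sum_k \sum_l (A i l * B k j) * Z l k.
  rewrite mxE; apply: eq_bigr => k _; rewrite mxE mulr_suml.
  by apply: eq_bigr => l _; rewrite mulrAC.
rewrite E (_ : (fun _ => _) = fun u => \sum_k \sum_l (A i l * B k j) * c u l k);
  last first.
  by apply/funext => u; rewrite E.
rewrite (_ : (fun _ => _) = \sum_k \sum_l (fun u => (A i l * B k j) * c u l k));
  last first.
  apply/funext => u; rewrite fct_sumE; apply: eq_bigr => k _.
  by rewrite fct_sumE.
by apply: is_derive_sum => k; apply: is_derive_sum => l; exact: is_deriveZ.
Qed.

Lemma der_inner (c : R -> 'M[R]_3) t X i j : is_derive t (1 : R) c X ->
  is_derive t (1 : R) (fun u => inner (row i (c u)) (row j (c u)))
     (inner (row i X) (row j (c t)) + inner (row i (c t)) (row j X)).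
Proof.
move=> /der_mxP dc; rewrite /inner !sum3E.
rewrite (_ : (fun _ => _) = fun u => c u i 0 * c u j 0 + c u i 1 * c u j 1
   + c u i 2 * c u j 2); last by apply/funext => u; rewrite sum3E !mxE.
apply: (der_eq (derD (derD (derM (dc i 0) (dc j 0)) (derM (dc i 1) (dc j 1)))
     (derM (dc i 2) (dc j 2)))).
rewrite !mxE; ring.
Qed.

(** * Velocities of curves in a leaf *)

(** The coordinates of X in the frame, if X is tangent to the leaf. *)
Definition vcoord a X : 'rV[R]_4 := \row_k ((Phi a)^-1 *
  nth 0 [:: (X *m a^T) 0 0; (X *m a^T) 2 1; (X *m a^T) 0 2; (X *m a^T) 1 0] k).

Lemma mul_tr_cof a : a^T *m cof a = (Phi a)%:M.
Proof.
by rewrite PhiE; apply/matrixP; do 2 apply: all3P;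
  rewrite !mxE sum3E !mxE !ord3E /= ?mulr1n ?mulr0n; ring.
Qed.

Lemma gram_entry X a i j : (X *m a^T) i j = inner (row i X) (row j a).
Proof. by rewrite mxE; apply: eq_bigr => k _; rewrite !mxE. Qed.

Lemma frame_vcoord a X : Phi a != 0 ->
  (forall i j, i != j -> (X *m a^T) i j = - (X *m a^T) j i) ->
  (X *m a^T) 0 0 = (X *m a^T) 1 1 -> (X *m a^T) 1 1 = (X *m a^T) 2 2 ->
  X = frame a (vcoord a X).
Proof.
move=> Phi0 skew e01 e12.
have E : X *m a^T = Phi a *: quat3 (vcoord a X).
  apply/matrixP; do 2 apply: all3P; rewrite [RHS]mxE [quat3 _ _ _]mxE /=
    ![vcoord _ _ _ _]mxE /= ?mulrN mulVKf //.
  - by rewrite skew.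
  - by rewrite skew.
  - by rewrite skew.
  - by rewrite -e12.
apply: (scalerI Phi0); rewrite -mul_mx_scalar -mul_tr_cof mulmxA E.
by rewrite -scalemxAl.
Qed.

Lemma metric_frame a c : Phi a != 0 ->
  metric a (frame a c) (frame a c) =
  - Phi a * (c 0 0 ^+ 2 + c 0 1 ^+ 2 + c 0 2 ^+ 2 + c 0 3 ^+ 2).
Proof. by move=> Phi0; rewrite metricE // mxE sum4E !mxE. Qed.

(** Curves are only required to stay in N near t: radial curves leave the leaf. *)
Definition velocity (N : set 'M[R]_3) (c : R -> 'M[R]_3) t X : Prop :=
  (\forall u \near t, N (c u)) /\ is_derive t (1 : R) c X.

Lemma leaf_Phi q r a : leaf q r a -> Phi a != 0.
Proof. by case=> _ _ _ /lt_eqF ->. Qed.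

Lemma velocity_in N (c : R -> 'M[R]_3) t X : velocity N c t X -> N (c t).
Proof. by case=> /nbhs_singleton. Qed.

(** Differentiating the equations of the leaf along the curve says that X a^T is the
    sum of a scalar and a skew matrix, which characterizes the tangent space. *)
Lemma velocity_frame q r (c : R -> 'M[R]_3) t X : velocity (leaf q r) c t X ->
  X = frame (c t) (vcoord (c t) X).
Proof.
move=> vX; have Nct := velocity_in vX; have [Nc dc] := vX.
have d0 k i j k' i' j' :
    (\forall u \near t, inner (row i (c u)) (row j (c u)) -
       k' * inner (row i' (c u)) (row j' (c u)) = k) ->
    inner (row i X) (row j (c t)) + inner (row i (c t)) (row j X) -
    k' * (inner (row i' X) (row j' (c t)) + inner (row i' (c t)) (row j' X)) = 0.
  move=> near_k.
  have := near_eq_is_derive near_k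
    (derD (der_inner i j dc) (derN (derM (der_cst k' t) (der_inner i' j' dc)))).
  rewrite mul0r add0r => h.
  exact: (der_uniq h (der_cst k t)).
apply: frame_vcoord; first exact: leaf_Phi Nct.
- move=> i j ne_ij; rewrite !gram_entry.
  have := @d0 0 i j 0 0 0.
  rewrite mul0r subr0 [inner (row i (c t)) _]innerC => /(_ _)/eqP.
  rewrite addr_eq0 => /(_ _)/eqP; apply.
  near=> u; rewrite mul0r subr0.
  have [+ _ _ _] : leaf q r (c u) by near: u.
  exact.
- rewrite !gram_entry; have := @d0 q 0 0 1 1 1.
  rewrite mul1r [inner (row 0 (c t)) _]innerC [inner (row 1 (c t)) _]innerC.
  move=> /(_ _) H; apply/eqP; rewrite -subr_eq0; apply/eqP.
  suff : inner (row 0 X) (row 0 (c t)) + inner (row 0 X) (row 0 (c t)) -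
      (inner (row 1 X) (row 1 (c t)) + inner (row 1 X) (row 1 (c t))) = 0 by lra.
  apply: H; near=> u; rewrite mul1r.
  by have [_ + _ _] : leaf q r (c u) by near: u.
- rewrite !gram_entry; have := @d0 r 1 1 1 2 2.
  rewrite mul1r [inner (row 1 (c t)) _]innerC [inner (row 2 (c t)) _]innerC.
  move=> /(_ _) H; apply/eqP; rewrite -subr_eq0; apply/eqP.
  suff : inner (row 1 X) (row 1 (c t)) + inner (row 1 X) (row 1 (c t)) -
      (inner (row 2 X) (row 2 (c t)) + inner (row 2 X) (row 2 (c t))) = 0 by lra.
  apply: H; near=> u; rewrite mul1r.
  by have [_ _ + _] : leaf q r (c u) by near: u.
Unshelve. all: by end_near. Qed.

Lemma velocity_metric q r (c : R -> 'M[R]_3) t X : velocity (leaf q r) c t X ->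
  metric (c t) X X = - (Phi (c t))^-1 * ((X *m (c t)^T) 0 0 ^+ 2 +
   (X *m (c t)^T) 2 1 ^+ 2 + (X *m (c t)^T) 0 2 ^+ 2 + (X *m (c t)^T) 1 0 ^+ 2).
Proof.
move=> vX; have Phi0 := leaf_Phi (velocity_in vX).
rewrite (velocity_frame vX) metric_frame // -(velocity_frame vX) !mxE /=.
by field.
Qed.

(** * Rotations *)

Lemma PhiM a g : Phi (a *m g) = Phi a * Phi g.
Proof. by rewrite !PhiE !mxE !sum3E; ring. Qed.

Lemma det_Phi a : \det a = Phi a.
Proof.
rewrite (expand_det_row _ 0) sum3E /cofactor !(expand_det_row _ 0) !big_ord_recl.
rewrite !big_ord0 /cofactor !det_mx11 !mxE /= PhiE.
rewrite (_ : lift 0 0 = 1 :> 'I_3); last exact: val_inj.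
rewrite (_ : lift 0 (lift ord0 ord0) = 2 :> 'I_3); last exact: val_inj.
rewrite (_ : lift 2 (lift ord0 ord0) = 1 :> 'I_3); last exact: val_inj.
rewrite (_ : lift 1 (lift ord0 ord0) = 2 :> 'I_3); last exact: val_inj.
rewrite (_ : lift 1 0 = 0 :> 'I_3); last exact: val_inj.
rewrite (_ : lift 2 0 = 0 :> 'I_3); last exact: val_inj.
rewrite (_ : lift 0 (lift (lift ord0 ord0) 0) = 1 :> 'I_3); last exact: val_inj.
rewrite (_ : lift 1 (lift (lift ord0 ord0) 0) = 0 :> 'I_3); last exact: val_inj.
rewrite (_ : lift 2 (lift (lift ord0 ord0) 0) = 0 :> 'I_3); last exact: val_inj.
rewrite (_ : (0 + 0)%N = 0%N) // (_ : (0 + bump 0 0)%N = 1%N) //.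
rewrite (_ : (0 + (1 %% 3 + 1 %% 3) %% 3)%N = 2%N) //.
by ring.
Qed.

Lemma SO3P g : SO3 g <-> g *m g^T = 1%:M /\ Phi g = 1.
Proof. by rewrite /SO3 /= det_Phi. Qed.

Lemma SO3_tr g : SO3 g -> SO3 g^T.
Proof.
by move=> [gg dg]; split; [rewrite trmxK; apply: mulmx1C | rewrite det_tr].
Qed.

Lemma SO3_mul g h : SO3 g -> SO3 h -> SO3 (g *m h).
Proof.
move=> [gg dg] [hh dh]; split; last by rewrite det_mulmx dg dh mulr1.
by rewrite trmx_mul mulmxA -[g *m h *m h^T]mulmxA hh mulmx1.
Qed.

(** The inverse transpose of a rotation is the rotation itself. *)
Lemma SO3_cof g : SO3 g -> cof g = g.
Proof.
move=> /SO3P[gg Pg]; have gg' := mulmx1C gg.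
by rewrite -[LHS]mulmx1 -gg' mulmxA mul_cof_tr Pg mul1mx.
Qed.

Lemma gram_Phi a : Phi a ^+ 2 = Phi (a *m a^T).
Proof. by rewrite -[RHS]det_Phi det_mulmx det_tr det_Phi. Qed.

(** The cross product by the j-th basis vector. *)
Definition Jmx (j : 'I_3) : 'M[R]_3 :=
  \matrix_(k, l) (((k == j + 2) && (l == j + 1))%:R -
                  ((k == j + 1) && (l == j + 2))%:R).

(** The rotation of angle u about the j-th axis, by the formula of Rodrigues. *)
Definition rotmx (j : 'I_3) (u : R) : 'M[R]_3 :=
  1%:M + sin u *: Jmx j + (1 - cos u) *: (Jmx j *m Jmx j).

Lemma tr_Jmx j : (Jmx j)^T = - Jmx j.
Proof. by apply/matrixP => k l; rewrite !mxE opprB; congr (_%:R - _%:R);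
  rewrite andbC. Qed.

Lemma Jmx3 j : Jmx j *m Jmx j *m Jmx j = - Jmx j.
Proof.
apply/matrixP; move: j; do 3 apply: all3P;
rewrite !mxE !sum3E !mxE !sum3E !mxE !ord3E /=; ring.
Qed.

Lemma rotmx_SO3 j u : SO3 (rotmx j u).
Proof.
have c2s2 := cos2Dsin2 u.
apply/SO3P; split.
  have J4 : Jmx j *m Jmx j *m (Jmx j *m Jmx j) = - (Jmx j *m Jmx j).
    by rewrite mulmxA Jmx3 mulNmx.
  have -> : (rotmx j u)^T = 1%:M - sin u *: Jmx j + (1 - cos u) *: (Jmx j *m Jmx j).
    rewrite /rotmx !linearD /= !linearZ /= tr_scalar_mx trmx_mul tr_Jmx.
    by rewrite mulmxN mulNmx opprK scalerN.
  rewrite /rotmx !(mulmxDl, mulmxDr, mul1mx, mulmx1, mulmxN, mulNmx).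
  rewrite -?scalemxAl -?scalemxAr !mulmxA Jmx3 mulNmx.
  rewrite {J4}; move: (Jmx j) (Jmx j *m Jmx j) => A B; apply/matrixP => k l.
  transitivity ((1%:M : 'M[R]_3) k l + (1 - (cos u ^+ 2 + sin u ^+ 2)) * B k l).
    by rewrite !mxE; ring.
  by rewrite c2s2 subrr mul0r addr0.
rewrite PhiE; move: j; apply: all3P; rewrite !mxE !sum3E !mxE !ord3E /=;
  transitivity (cos u ^+ 2 + sin u ^+ 2); [ring|by []|ring|by []|ring|by []].
Qed.

(** * Polar coordinates on a leaf *)

(** The squared lengths of the three rows of a point of the leaf, given that of the
    last row. *)
Definition sqlen (q r s : R) (j : 'I_3) : R := nth 0 [:: s + r + q; s + r; s] j.

(** The minus sign makes g a rotation: on the leaf Phi is negative. *)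
Definition polar (q r s : R) g : 'M[R]_3 :=
  \matrix_(j, k) (- Num.sqrt (sqlen q r s j) * g j k).

Lemma sqlen_gt0 (q r s : R) j : 0 <= q -> 0 <= r -> 0 < s -> 0 < sqlen q r s j.
Proof. by move=> q0 r0 s0; move: j; apply: all3P; rewrite /sqlen /=; lra. Qed.

Lemma polar_gram q r s g h i j :
  (polar q r s g *m (polar q r s h)^T) i j =
  Num.sqrt (sqlen q r s i) * Num.sqrt (sqlen q r s j) * (g *m h^T) i j.
Proof.
rewrite !mxE mulr_sumr; apply: eq_bigr => k _; rewrite !mxE; ring.
Qed.

Lemma Phi_polar q r s g : Phi (polar q r s g) =
  - (Num.sqrt (s + r + q) * Num.sqrt (s + r) * Num.sqrt s) * Phi g.
Proof. by rewrite !PhiE !mxE /sqlen /=; ring. Qed.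

Lemma polar_leaf (q r s : R) g : 0 <= q -> 0 <= r -> 0 < s -> SO3 g ->
  leaf q r (polar q r s g).
Proof.
move=> q0 r0 s0 /SO3P[gg Pg].
have G i j : inner (row i (polar q r s g)) (row j (polar q r s g)) =
    if i == j then sqlen q r s i else 0.
  rewrite -gram_entry polar_gram gg mxE; case: eqP => [->|_]; last by rewrite mulr0.
  by rewrite mulr1 -expr2 sqr_sqrtr // ltW // sqlen_gt0.
split.
- by move=> i j /negPf ij; rewrite G ij.
- by rewrite !G !eqxx /sqlen /=; ring.
- by rewrite !G !eqxx /sqlen /=; ring.
rewrite Phi_polar Pg mulr1 oppr_lt0 !mulr_gt0 ?sqrtr_gt0 //; lra.
Qed.

Lemma leaf_gram (q r : R) a : leaf q r a -> 0 <= q -> 0 <= r ->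
  exists2 s : R, 0 < s & a *m a^T = diag_mx (\row_j sqlen q r s j).
Proof.
move=> [ort eq er Pa] q0 r0; exists (inner (row 2 a) (row 2 a)); last first.
  apply/matrixP => i j; rewrite gram_entry !mxE; have [->|/ort->//] := eqVneq i j.
  by rewrite mulr1n; move: j; apply: all3P; rewrite /sqlen /=; lra.
have ge0 i : 0 <= inner (row i a) (row i a) by apply: sumr_ge0 => k _; exact: sqr_ge0.
rewrite lt_neqAle ge0 andbT; apply/eqP => n2.
have := gram_Phi a; rewrite [Phi (a *m _)]PhiE !gram_entry -n2 (ort 0 1) // (ort
  0 2) // (ort 1 2) // (ort 1 0) //.
rewrite !(mul0r, mulr0, subr0, addr0) => /eqP; rewrite sqrf_eq0.
by rewrite (lt_eqF Pa).
Qed.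

(** The rows of a are orthogonal, so dividing them by their lengths gives an
    orthogonal matrix; the sign of Phi fixes its determinant. *)
Lemma leaf_polar (q r : R) a : leaf q r a -> 0 <= q -> 0 <= r ->
  exists (s : R) g, [/\ 0 < s, SO3 g & a = polar q r s g].
Proof.
move=> La q0 r0; have [s s0 aa] := leaf_gram La q0 r0; have [_ _ _ Pa] := La.
have l0 j := @sqlen_gt0 q r s j q0 r0 s0.
have sq0 j : Num.sqrt (sqlen q r s j) != 0 by rewrite gt_eqF // sqrtr_gt0.
pose g : 'M[R]_3 := \matrix_(j, k) (- (Num.sqrt (sqlen q r s j))^-1 * a j k).
have gg : g *m g^T = 1%:M.
  apply/matrixP => i j; transitivity ((Num.sqrt (sqlen q r s i))^-1 * (Num.sqrt
    (sqlen q r s j))^-1 * (a *m a^T) i j).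
    rewrite !mxE mulr_sumr; apply: eq_bigr => k _; rewrite !mxE; ring.
  rewrite aa !mxE; case: eqP => [->|_]; last by rewrite mulr0n mulr0.
  rewrite /= mulr1n -[X in _ * X](sqr_sqrtr (ltW (l0 j))); by field.
have ag : a = polar q r s g.
  by apply/matrixP => j k; rewrite !mxE mulrA mulrNN mulfV // mul1r.
exists s, g; split=> //; apply/SO3P; split=> //.
have : Phi g ^+ 2 = 1 by rewrite gram_Phi gg PhiE !mxE /=; ring.
move=> /eqP; rewrite sqrf_eq1 => /orP[/eqP//|/eqP Pg].
move: Pa; rewrite ag Phi_polar Pg mulrN1 opprK => /lt_geF.
by rewrite !mulr_ge0 // sqrtr_ge0.
Qed.

(** The orbit of a point under the turns about its own j-th row; its velocity is a
    multiple of V_(j+1). *)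
Definition turn q r s g j (u : R) := polar q r s (rotmx j u *m g).

Lemma rotmxE j u k l : rotmx j u k l = (1%:M : 'M[R]_3) k l + sin u * Jmx j k l +
  (1 - cos u) * (Jmx j *m Jmx j) k l.
Proof. by rewrite /rotmx; move: (Jmx j) (Jmx j *m _) => A B; rewrite !mxE. Qed.

Lemma der_rotmx j (u : R) k l :
  is_derive u (1 : R) (fun v => rotmx j v k l) ((Jmx j *m rotmx j u) k l).
Proof.
rewrite (_ : (fun _ => _) = fun v : R => (1%:M : 'M[R]_3) k l + sin v * Jmx j k l +
  (1 - cos v) * (Jmx j *m Jmx j) k l); last by apply/funext => v; rewrite rotmxE.
apply: (der_eq (derD (derD (der_cst _ _) (derM (is_derive_sin u) (der_cst _ _)))
  (derM (derD (der_cst 1 _) (derN (is_derive_cos u))) (der_cst _ _)))).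
rewrite /rotmx !mulmxDr mulmx1 -!scalemxAr mulmxA Jmx3.
by move: (Jmx j *m Jmx j) (Jmx j) => B A; rewrite !mxE; ring.
Qed.

Lemma turn_velocity q r s g j (u : R) (a := turn q r s g j u) : 0 <= q -> 0 <=
  r -> 0 < s -> SO3 g ->
  exists X, [/\ velocity (leaf q r) (turn q r s g j) u X &
    forall k l, (X *m a^T) k l =
      Num.sqrt (sqlen q r s k) * Num.sqrt (sqlen q r s l) * Jmx j k l].
Proof.
move=> q0 r0 s0 Sg; exists (polar q r s (Jmx j *m rotmx j u *m g)); split.
  split; first by near=> v; apply: polar_leaf => //; exact:
    SO3_mul (rotmx_SO3 _ _) Sg.
  apply/der_mxP => k l; rewrite mxE.
  rewrite (_ : (fun _ => _) = fun v => - Num.sqrt (sqlen q r s k) *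
     (rotmx j v k 0 * g 0 l + rotmx j v k 1 * g 1 l + rotmx j v k 2 * g 2 l));
       last first.
    by apply/funext => v; rewrite mxE [(_ *m _) _ _]mxE sum3E.
  have D i := derM (der_rotmx j u k i) (der_cst (g i l) u).
  apply: (der_eq (derM (der_cst _ _) (derD (derD (D 0) (D 1)) (D 2)))).
  by rewrite mul0r add0r [in RHS]mxE sum3E !mulr0 !addr0.
move=> k l; have [Hg _] := SO3_mul (rotmx_SO3 j u) Sg.
by rewrite /a /turn polar_gram -[Jmx j *m _ *m g]mulmxA -mulmxA Hg mulmx1.
Unshelve. all: by end_near. Qed.

Lemma radial_velocity (q r s : R) g (a := polar q r s g) : 0 <= q -> 0 <= r ->
  0 < s -> SO3 g ->
  exists X, velocity (leaf q r) (fun u => polar q r u g) s X /\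
    forall k l, (X *m a^T) k l = 2^-1 * (k == l)%:R.
Proof.
move=> q0 r0 s0 Sg.
exists (\matrix_(j, k) (- (2 * Num.sqrt (sqlen q r s j))^-1 * g j k)); split.
  split; first by near=> v; apply: polar_leaf => //; near: v; exact: lt_nbhsr.
  apply/der_mxP => k l; rewrite mxE.
  rewrite (_ : (fun _ => _) = fun v => - Num.sqrt (sqlen q r v k) * g k l);
    last first.
    by apply/funext => v; rewrite mxE.
  have dl : is_derive s (1 : R) (fun v => sqlen q r v k) 1.
    move: k; apply: all3P; rewrite /sqlen /=.
    - by apply: (der_eq (derD (derD (is_derive_id _ _) (der_cst _ _)) (der_cst _
      _))); rewrite !addr0.
    - by apply: (der_eq (derD (is_derive_id _ _) (der_cst _ _))); rewrite !addr0.
    - exact: is_derive_id.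
  apply: (der_eq (derM (derN (der_sqrt dl (sqlen_gt0 _ q0 r0 s0))) (der_cst _ _))).
  by rewrite mulr0 addr0 mul1r.
move=> k l; have [Hg _] := Sg.
transitivity ((2 * Num.sqrt (sqlen q r s k))^-1 * Num.sqrt (sqlen q r s l) * (g
  *m g^T) k l).
  rewrite !mxE mulr_sumr; apply: eq_bigr => i _; rewrite !mxE; ring.
rewrite Hg mxE; case: eqP => [->|_]; last by rewrite !mulr0.
have := sqlen_gt0 l q0 r0 s0; rewrite -sqrtr_gt0 => h.
rewrite !mulr1; field; by rewrite gt_eqF.
Unshelve. all: by end_near. Qed.

(** * Tangent maps *)

Lemma smooth_differentiable (U : set 'M[R]_3) (G : 'M[R]_3 -> 'M[R]_3) x :
  smooth U G -> U x -> differentiable G x.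
Proof. by move=> /(_ 1%N)[+ _]; exact. Qed.

Lemma tangent_map_ext (N : set 'M[R]_3) F a : smooth_on N F -> N a ->
  exists2 G, local_extension N F a G & tangent_map N F a = 'd G a :> ('M[R]_3 ->
    'M[R]_3).
Proof.
move=> sF Na; exists (xget F [set G | local_extension N F a G]) => //.
exact: (xgetPex F (sF a Na)).
Qed.

Lemma tangent_map_linear (N : set 'M[R]_3) F a (k : R) X Y : smooth_on N F -> N a ->
  tangent_map N F a (k *: X + Y) = k *: tangent_map N F a X + tangent_map N F a Y.
Proof. by move=> sF Na; have [G _ ->] := tangent_map_ext sF Na; exact: linearP. Qed.

(** Along a curve in N the extension and the map agree, so the derivative of the
    extension in a direction tangent to N is determined by the map. *)
Lemma local_extension_curve (N : set 'M[R]_3) F G (c : R -> 'M[R]_3) (t : R) X :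
  local_extension N F (c t) G -> velocity N c t X ->
  is_derive t (1 : R) (F \o c) ('d G (c t) X).
Proof.
move=> [U [oU Uct sG GF]] [Nc dc].
have cdiff : differentiable c t by apply/derivable1_diffP; exact: dc.(ex_derive).
have Gdiff := smooth_differentiable sG Uct.
have GcE : is_derive t (1 : R) (G \o c) ('d G (c t) X).
  apply: DeriveDef; first by apply/derivable1_diffP; exact: differentiable_comp.
  rewrite deriveE; last exact: differentiable_comp.
  by rewrite diff_comp //= -(deriveE _ cdiff) dc.(derive_val).
apply: near_eq_is_derive GcE; near=> u => /=; apply: GF; first by near: u.
near: u; apply: (differentiable_continuous cdiff); exact: open_nbhs_nbhs.
Unshelve. all: by end_near. Qed.

Lemma tangent_map_curve (N : set 'M[R]_3) F (c : R -> 'M[R]_3) (t : R) X :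
  smooth_on N F -> velocity N c t X ->
  is_derive t (1 : R) (F \o c) (tangent_map N F (c t) X).
Proof.
move=> sF vX; have [G eG ->] := tangent_map_ext sF (velocity_in vX).
exact: local_extension_curve eG vX.
Qed.

Lemma velocity_image (N N' : set 'M[R]_3) F (c : R -> 'M[R]_3) (t : R) X :
  smooth_on N F -> (forall a, N a -> N' (F a)) -> velocity N c t X ->
  velocity N' (F \o c) t (tangent_map N F (c t) X).
Proof.
move=> sF NN' vX; split; last exact: tangent_map_curve.
by case: vX => + _; apply: filterS => u; exact: NN'.
Qed.

Lemma mul_tr_inj a X Y : Phi a != 0 -> X *m a^T = Y *m a^T -> X = Y.
Proof.
move=> Phi0 XY; apply: (scalerI Phi0).
by rewrite -![_ *: _]mul_mx_scalar -mul_tr_cof !mulmxA XY.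
Qed.

Lemma rotmx0 j : rotmx j 0 = 1%:M.
Proof. by rewrite /rotmx sin0 cos0 subrr !scale0r !addr0. Qed.

Lemma quat3_Jmx j : quat3 (delta_mx 0 (lift ord0 j)) = Jmx j.
Proof.
by apply/matrixP; move: j; do 3 apply: all3P; rewrite !mxE !ord3E /= ?mxE //=
  ?subr0 ?sub0r ?oppr0.
Qed.

(** V_0 is radial and V_1, V_2, V_3 are the velocities of the three turns, up to
    factors. *)
Lemma frame_velocity q r a k : leaf q r a -> 0 <= q -> 0 <= r ->
  exists (c : R -> 'M[R]_3) (t : R) X (kappa : R),
    [/\ c t = a, velocity (leaf q r) c t X & frame a (delta_mx 0 k) = kappa *: X].
Proof.
move=> La q0 r0; have Pa := leaf_Phi La.
have [s [g [s0 Sg aE]]] := leaf_polar La q0 r0.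
have [->|[j ->]] : k = 0 \/ exists j, k = lift ord0 j.
  case: (unliftP ord0 k) => [j ->|->]; [right; by exists j|left; exact: val_inj].
- have [X [vX XE]] := radial_velocity q0 r0 s0 Sg.
  exists (fun u => polar q r u g), s, X, (Phi a * 2); split=> //.
  apply: (mul_tr_inj Pa); rewrite frame_mul_tr -scalemxAl -scalerA; congr (_ *: _).
  apply/matrixP => i l; rewrite [RHS]mxE aE XE mulVKf ?pnatr_eq0 //.
  by move: i l; do 2 apply: all3P; rewrite !mxE /= ?mxE //= ?oppr0.
- have [X [vX XE]] := turn_velocity j 0 q0 r0 s0 Sg.
  have turn0 : turn q r s g j 0 = a by rewrite /turn rotmx0 mul1mx.
  pose m := Num.sqrt (sqlen q r s (j + 1)) * Num.sqrt (sqlen q r s (j + 2)).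
  have m0 : m != 0 by rewrite mulf_neq0 // gt_eqF // sqrtr_gt0 sqlen_gt0.
  exists (turn q r s g j), 0, X, (Phi a / m); split=> //.
  apply: (mul_tr_inj Pa); rewrite frame_mul_tr -scalemxAl -scalerA; congr (_ *: _).
  apply/matrixP => i l; rewrite [RHS]mxE quat3_Jmx -turn0 XE !mxE.
  rewrite mulrA.
  case: (boolP ((i == j + 2) && (l == j + 1))) => [/andP[/eqP -> /eqP ->]|_].
    by rewrite (_ : j + 2 == j + 1 =
      false) ?subr0 ?mulr1 /m 1?[X in _^-1 * X]mulrC ?mulVf //; move:
      j {X vX XE turn0 m m0}; apply: all3P.
  case: (boolP ((i == j + 1) && (l == j + 2))) => [/andP[/eqP -> /eqP ->]|_].
    by rewrite sub0r /m mulrN1 mulVf.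
  by rewrite subrr mulr0.
Qed.

(** * Isomorphisms are isometries *)

Lemma SO3_inner g i j : SO3 g -> inner (row i g) (row j g) = (i == j)%:R.
Proof. by move=> [gg _]; rewrite -gram_entry gg mxE. Qed.

(** For an oriented orthonormal basis u, v, w of imaginary quaternions, u v = w and
    w w = -1; qmx reverses the order of the factors. *)
Lemma qmx_SO3_prod g : SO3 g ->
  qmx 0 (row 1 g) *m qmx 0 (row 0 g) *m qmx 0 (row 2 g) = - 1%:M.
Proof.
move=> Sg; rewrite qmxM (SO3_inner _ _ Sg) /= !scale0r mul0r subr0 !add0r.
have -> : - lie (row 1 g) (row 0 g) = row 2 g.
  by rewrite lieC opprK -[in RHS](SO3_cof Sg) row_cof !ord3E.
by rewrite qmxM (SO3_inner _ _ Sg) eqxx mul0r !scale0r lie_self !addr0 subr0 sub0r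
  qmx_scalar raddfN.
Qed.

Lemma qmxK g i : SO3 g -> qmx 0 (row i g) *m qmx 0 (row i g) = - 1%:M.
Proof.
by move=> Sg; rewrite qmxM (SO3_inner _ _ Sg) eqxx mul0r !scale0r lie_self !addr0
  subr0 sub0r qmx_scalar raddfN.
Qed.

(** From T C_0 T^T = D_0 (up to mu) follows T^T D_0 T = C_0. Hence
    D_1 D_0 D_2 = T C_1 T^T D_0 T C_2 T^T = T C_1 C_0 C_2 T^T, and both triple
    products are -1. *)
Lemma conformal_of_triple (T : 'M[R]_4) (mu : R) g : SO3 g ->
  (forall i, mu *: (T *m Cmx i *m T^T) = qmx 0 (row i g)) ->
  mu *: (T *m T^T) = 1%:M.
Proof.
move=> Sg TE.
(* T is invertible because D_0 is. *)
have inv0 : T *m (mu *: (Cmx 0 *m T^T *m - qmx 0 (row 0 g))) = 1%:M.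
  rewrite -scalemxAr !mulmxA scalemxAl TE mulmxN qmxK //.
  by rewrite opprK.
have E0 : mu *: (T^T *m qmx 0 (row 0 g) *m T) = Cmx 0.
  have /(congr1 (mulmx (Cmx 0))) := mulmx1C inv0.
  by rewrite mulmx1 -scalemxAl -scalemxAr !(mulmxN, mulNmx, mulmxA) CmxK
    !mulNmx mul1mx opprK.
have := qmx_SO3_prod Sg; rewrite -{1}TE -(TE 2) -scalemxAl -scalemxAl -scalemxAr.
rewrite (_ : T *m Cmx 1 *m T^T *m qmx 0 (row 0 g) *m (T *m Cmx 2 *m T^T) =
   T *m Cmx 1 *m (T^T *m qmx 0 (row 0 g) *m T) *m Cmx 2 *m T^T);
     last by rewrite !mulmxA.
(* Push mu inside, to the factor that E0 rewrites. *)
have scaleE (A M B P : 'M[R]_4) :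
    mu *: (A *m M *m B *m P) = A *m (mu *: M) *m B *m P.
  by rewrite -scalemxAr -!scalemxAl.
rewrite scaleE E0 -[T *m _ *m _]mulmxA -[T *m _ *m Cmx 2]mulmxA.
by rewrite Cmx_prod mulmxN mulmx1 mulNmx scalerN => /oppr_inj.
Qed.

Lemma form_inj (M M' : 'M[R]_4) :
  (forall c d, (c *m M *m d^T) 0 0 = (c *m M' *m d^T) 0 0) -> M = M'.
Proof.
move=> MM'; apply/matrixP => i j.
have E (P : 'M[R]_4) : ((delta_mx 0 i : 'rV_4) *m P *m (delta_mx 0 j :
  'rV_4)^T) 0 0 = P i j.
  by rewrite -rowE trmx_delta -colE !mxE.
by rewrite -!E MM'.
Qed.

Lemma sum_Cmx (O : 'M[R]_3) i : \sum_j O j i *: Cmx j = qmx 0 (row i O^T).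
Proof.
apply/matrixP; do 2 apply: all4P; rewrite sum3E !mxE /= ?mxE /=; ring.
Qed.

Lemma frame_linear a (k : R) c d : frame a (k *: c + d) = k *: frame a c + frame a d.
Proof.
rewrite /frame scalemxAl -mulmxDl; congr (_ *m _).
by apply/matrixP; do 2 apply: all3P; rewrite !mxE /= ?mxE ?opprD ?mulrN.
Qed.

Lemma frame0 a : frame a 0 = 0.
Proof.
rewrite /frame (_ : quat3 0 = 0) ?mul0mx //.
by apply/matrixP; do 2 apply: all3P; rewrite !mxE /= ?mxE ?oppr0.
Qed.

(** The images of the V_k are tangent to the target since V_k is the velocity of a
    curve in the leaf, and the tangent map is linear. *)
Lemma tangent_map_frame q r q' r' F a : smooth_on (leaf q r) F ->
  (forall b, leaf q r b -> leaf q' r' (F b)) -> 0 <= q -> 0 <= r -> leaf q r a ->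
  exists T : 'M[R]_4, forall c,
    tangent_map (leaf q r) F a (frame a c) = frame (F a) (c *m T).
Proof.
move=> sF NN' q0 r0 La.
have t0 : tangent_map (leaf q r) F a 0 = 0.
  by have [G _ ->] := tangent_map_ext sF La; exact: linear0.
have H k : exists d, tangent_map (leaf q r) F a (frame a (delta_mx 0 k)) =
  frame (F a) d.
  have [c [t [X [kappa [cta vX ->]]]]] := frame_velocity k La q0 r0.
  exists (kappa *: vcoord (F a) (tangent_map (leaf q r) F a X)).
  have := velocity_frame (velocity_image sF NN' vX); rewrite /= cta => E.
  rewrite -[kappa *: X]addr0 tangent_map_linear // t0 {1}E.
  by rewrite -(frame0 (F a)) -frame_linear addr0.
have [d dE] := choice H.
exists (\matrix_(k, l) d k 0 l) => c.
rewrite {1}(matrix_sum_delta c) mulmx_sum_row big_ord1.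
elim/big_rec2: _ => [|k x y _ IH]; first by rewrite !frame0 t0.
rewrite frame_linear tangent_map_linear // IH frame_linear dE.
by congr (_ *: frame _ _ + _); apply/rowP => l; rewrite !mxE.
Qed.

Lemma hyperkahler_isometry q r q' r' F (c : R -> 'M[R]_3) (t : R) X :
  0 <= q -> 0 <= r ->
  hyperkahler_isomorphism (leaf q r) (leaf q' r') F ->
  velocity (leaf q r) c t X ->
  exists2 Y, velocity (leaf q' r') (F \o c) t Y &
    metric (F (c t)) Y Y = metric (c t) X X.
Proof.
move=> q0 r0 [[G [sF _ FN _]] [B SB FB]] vX.
have NN' b : leaf q r b -> leaf q' r' (F b) by case/FN.
have La := velocity_in vX; have Pa := leaf_Phi La; have PFa := leaf_Phi (NN' _ La).
exists (tangent_map (leaf q r) F (c t) X); first exact: velocity_image.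
have [T TE] := tangent_map_frame sF NN' q0 r0 La.
rewrite (velocity_frame vX) TE !metricE // trmx_mul.
move: (vcoord _ _) => e; set a := c t in La Pa PFa TE *.
pose mu := Phi (F a) / Phi a.
suff : mu *: (T *m T^T) = 1%:M.
  move=> H; rewrite mulmxA -[e *m T *m _]mulmxA.
  have -> : T *m T^T = mu^-1 *: 1%:M.
    by rewrite -H scalerA mulVf ?scale1r // mulf_neq0 // invr_neq0.
  by rewrite -scalemxAr mulmx1 -scalemxAl mxE /mu; field; rewrite Pa.
apply: (conformal_of_triple (SO3_tr SB)) => i.
rewrite -sum_Cmx; apply: form_inj => u v.
have := FB a (frame a u) (frame a v) i La.
have tF w : leaf_tangent a (frame a w) by apply/leaf_tangentP => //; eexists.
move=> /(_ (tF u) (tF v)); rewrite !TE omegaE // trmx_mul => H.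
apply: (mulfI (_ : - Phi a != 0)); first by rewrite oppr_eq0.
rewrite mulmx_sumr mulmx_suml summxE mulr_sumr.
transitivity (\sum_j omega j a (frame a u) (frame a v) * B j i); last first.
  by apply: eq_bigr => j _; rewrite omegaE // -scalemxAr -scalemxAl [in RHS]mxE; ring.
rewrite -H -scalemxAr -scalemxAl [in LHS]mxE !mulmxA /mu; by field.
Qed.

(** * Short functions and wide sets *)

(** Bounding the derivative along all curves, instead of the differential on the
    tangent spaces, makes the class of short functions functorial by the chain
    rule along curves. *)
Definition short (N : set 'M[R]_3) (f : 'M[R]_3 -> R) : Prop :=
  forall (c : R -> 'M[R]_3) (t : R) X, velocity N c t X ->
  exists2 y, is_derive t (1 : R) (f \o c) y & y ^+ 2 <= metric (c t) X X.

(** Closed balls for the distance defined by the short functions. *)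
Definition short_ball (N : set 'M[R]_3) x (rho : R) : set 'M[R]_3 :=
  [set z | N z /\ forall f, short N f -> `|f z - f x| <= rho].

Definition relatively_compact (N A : set 'M[R]_3) : Prop :=
  exists K, [/\ compact K, K `<=` N & A `<=` K].

(** If the ball of radius rho about x is not relatively compact, then the missing
    boundary is at distance at most rho from x. *)
Definition wide (N : set 'M[R]_3) (M : R) : Prop :=
  exists x y (rho : R), [/\ N x /\ N y, 0 < rho,
    ~ relatively_compact N (short_ball N x rho),
    ~ relatively_compact N (short_ball N y rho) &
    exists2 f, short N f & M * rho <= f x - f y].

Lemma smooth_on_continuous (N K : set 'M[R]_3) F :
  smooth_on N F -> K `<=` N -> {within K, continuous F}.
Proof.
move=> sF KN; apply/subspace_continuousP => x Kx.
have [G [U [oU Ux sG GF]]] := sF x (KN _ Kx).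
have Gx := differentiable_continuous (smooth_differentiable sG Ux).
change (F @ within K (nbhs x) --> F x).
rewrite -(GF x) //; last exact: KN.
have Gx' : G @ within K (nbhs x) --> G x by exact: cvg_within_filter.
apply: (cvg_trans _ Gx'); apply: near_eq_cvg.
near=> z; apply: GF; last by near: z; apply: cvg_within; exact: open_nbhs_nbhs.
by apply: KN; near: z; exact: withinT.
Unshelve. all: by end_near. Qed.

Section transport.
Context (N N' : set 'M[R]_3) (F G : 'M[R]_3 -> 'M[R]_3).
Context (sG : smooth_on N' G) (FN : forall a, N a -> N' (F a) /\ G (F a) = a)
  (GN : forall b, N' b -> N (G b))
  (pullF : forall f, short N' f -> short N (f \o F))
  (pullG : forall f, short N f -> short N' (f \o G)).

(** F maps the ball about x into the ball about F x, so a compact set around the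
    latter is carried back by G to a compact set around the former. *)
Lemma transport_ball x rho : N x ->
  ~ relatively_compact N (short_ball N x rho) ->
  ~ relatively_compact N' (short_ball N' (F x) rho).
Proof.
move=> Nx ncN [K [cK KN' bK]]; apply: ncN; exists (G @` K); split.
- by apply: continuous_compact => //; exact: smooth_on_continuous sG KN'.
- by move=> _ [b Kb <-]; apply: GN; exact: KN'.
- move=> z [Nz fz]; have [N'z GFz] := FN Nz; exists (F z) => //.
  by apply: bK; split=> // f sf; exact: (fz _ (pullF sf)).
Qed.

Lemma transport_wide M : wide N M -> wide N' M.
Proof.
move=> [x [y [rho [[Nx Ny] rho0 ncx ncy [f sf fxy]]]]].
exists (F x), (F y), rho; split.
- by split; [case: (FN Nx)|case: (FN Ny)].
- by [].
- exact: transport_ball.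
- exact: transport_ball.
exists (f \o G); first exact: pullG.
by rewrite /= (FN Nx).2 (FN Ny).2.
Qed.

End transport.

Lemma wide_isomorphic q r q' r' M : 0 <= q -> 0 <= r ->
  hyperkahler_isomorphic (leaf q r) (leaf q' r') ->
  wide (leaf q r) M <-> wide (leaf q' r') M.
Proof.
move=> q0 r0 [F isoF]; have [[G [sF sG FN GN]] _] := isoF.
have pullF f : short (leaf q' r') f -> short (leaf q r) (f \o F).
  move=> sf c t X vX; have [Y vY <-] := hyperkahler_isometry q0 r0 isoF vX.
  exact: (sf _ _ _ vY).
have pullG f : short (leaf q r) f -> short (leaf q' r') (f \o G).
  move=> sf c t Y vY; have vX := velocity_image sG (fun b Nb => (GN b Nb).1) vY.
  have [y dy yX] := sf _ _ _ vX; exists y => //.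
  have [Y' [_ dY'] XY'] := hyperkahler_isometry q0 r0 isoF vX.
  have Nct := velocity_in vY; move: XY'; rewrite /= (GN _ Nct).2.
  suff -> : Y' = Y by move=> ->.
  apply: der_uniq vY.2; apply: near_eq_is_derive dY'.
  case: vY => Nc _; near=> u => /=; apply: (GN _ _).2; by near: u.
split.
- exact: (@transport_wide _ _ F G sG FN (fun b Nb => (GN b Nb).1) pullF pullG).
- exact: (@transport_wide _ _ G F sF GN (fun a Na => (FN a Na).1) pullG pullF).
Unshelve. all: by end_near. Qed.

End leaf_isometries.

Section leaf_invariants.
Context {R : realType}.
Implicit Types (a g X Y : 'M[R]_3) (q r s M rho : R).

(** * Short functions on a leaf *)

Definition sqnorm a j : R := inner (row j a) (row j a).

(** The absolute value of Phi on the leaf, which is also the squared norm of V_0. *)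
Definition vol q r s : R := Num.sqrt (s + r + q) * Num.sqrt (s + r) * Num.sqrt s.

Lemma sqnorm_polar q r s g j : 0 <= q -> 0 <= r -> 0 < s -> SO3 g ->
  sqnorm (polar q r s g) j = sqlen q r s j.
Proof.
move=> q0 r0 s0 Sg; rewrite /sqnorm -gram_entry polar_gram Sg.1 mxE eqxx mulr1.
by rewrite -expr2 sqr_sqrtr // ltW // sqlen_gt0.
Qed.

Lemma cof_polar q r s g j k : SO3 g -> cof (polar q r s g) j k =
  Num.sqrt (sqlen q r s (j + 1)) * Num.sqrt (sqlen q r s (j + 2)) * g j k.
Proof.
by move=> Sg; rewrite -[in RHS](SO3_cof Sg) !mxE; ring.
Qed.

Lemma vol_gt0 q r s : 0 <= q -> 0 <= r -> 0 < s -> 0 < vol q r s.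
Proof. by move=> q0 r0 s0; rewrite !mulr_gt0 // sqrtr_gt0; lra. Qed.

(** All entries of a and cof a are known in polar coordinates, so the derivatives of
    the functions used below can be read off from the frame. *)
Lemma velocity_polar q r (c : R -> 'M[R]_3) (t : R) X : 0 <= q -> 0 <= r ->
  velocity (leaf q r) c t X ->
  exists s g (e0 e1 e2 e3 : R), [/\ 0 < s, SO3 g, c t = polar q r s g,
    metric (c t) X X = vol q r s * (e0 ^+ 2 + e1 ^+ 2 + e2 ^+ 2 + e3 ^+ 2) &
    (forall j, is_derive t (1 : R) (fun u =>
      sqnorm (c u) j) (- (2 * vol q r s * e0))) /\
    is_derive t (1 : R) (fun u => c u 0 0)
      (Num.sqrt (s + r) * Num.sqrt s * e0 * g 0 0
       - Num.sqrt s * Num.sqrt (s + r + q) * e3 * g 1 0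
       + Num.sqrt (s + r + q) * Num.sqrt (s + r) * e2 * g 2 0)].
Proof.
move=> q0 r0 vX; have Nct := velocity_in vX; have Pa := leaf_Phi Nct.
have [s [g [s0 Sg aE]]] := leaf_polar Nct q0 r0.
have XE := velocity_frame vX; have dc := vX.2; move: XE; set e := vcoord _ _ => XE.
have volE : Phi (c t) = - vol q r s.
  by rewrite aE Phi_polar; have [_ ->] := (SO3P g).1 Sg; rewrite mulr1.
exists s, g, (e 0 0), (e 0 1), (e 0 2), (e 0 3); split=> //.
  by rewrite XE metric_frame // volE opprK.
split=> [j|].
  apply: (der_eq (der_inner j j dc)); rewrite [X in _ + X]innerC -gram_entry.
  rewrite {1 2}XE frame_mul_tr volE mxE.
  by move: j; apply: all3P; rewrite mxE /=; ring.
apply: (der_eq ((der_mxP _ _ _).1 dc 0 0)).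
by rewrite XE /frame mxE sum3E aE !cof_polar // !ord3E !mxE /sqlen /=; ring.
Qed.

(** This function only sees V_0. It is the distance to the apex in type 0, and in
    all types it tends to infinity with a, which confines balls. *)
Lemma short_norm q r : 0 <= q -> 0 <= r ->
  short (leaf q r) (fun a => 2 * Num.sqrt (Num.sqrt (sqnorm a 0))).
Proof.
move=> q0 r0 c t X vX.
have [s [g [e0 [e1 [e2 [e3 [s0 Sg ctE -> [dn _]]]]]]]] := velocity_polar q0 r0 vX.
have n0 : sqnorm (c t) 0 = s + r + q by rewrite ctE sqnorm_polar.
have n0_gt0 : 0 < sqnorm (c t) 0 by rewrite n0; lra.
have d0_gt0 : 0 < Num.sqrt (sqnorm (c t) 0) by rewrite sqrtr_gt0.
exists (- (Num.sqrt (s + r) * Num.sqrt s * e0 / Num.sqrt (Num.sqrt (s + r + q)))).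
  rewrite /comp; apply: (der_eq (derM (der_cst 2 t) (der_sqrt (der_sqrt (dn 0)
    n0_gt0) d0_gt0))).
  rewrite n0 /vol; move: d0_gt0; rewrite n0 => d0_gt0.
  move: (d0_gt0); rewrite -sqrtr_gt0 => dd0_gt0.
  by field; rewrite !gt_eqF.
move: d0_gt0; rewrite n0 /vol => d0_gt0.
rewrite sqrrN exprMn exprVn (sqr_sqrtr (sqrtr_ge0 _)) ler_pdivrMr //.
have d1 : Num.sqrt (s + r) <= Num.sqrt (s + r + q) by rewrite ler_wsqrtr //; lra.
have d2 : Num.sqrt s <= Num.sqrt (s + r + q) by rewrite ler_wsqrtr //; lra.
have d1_0 : 0 <= Num.sqrt (s + r) by rewrite sqrtr_ge0.
have d2_0 : 0 <= Num.sqrt s by rewrite sqrtr_ge0.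
set x := Num.sqrt (s + r + q) in d0_gt0 d1 d2 *.
set y := Num.sqrt (s + r) in d1 d1_0 *; set z := Num.sqrt s in d2 d2_0 *.
have yz : y * z <= x * x by apply: ler_pM.
have yz0 : 0 <= y * z by apply: mulr_ge0.
rewrite exprMn (_ : x * y * z * _ * x =
  (y * z) * (x * x * (e0 ^+ 2 + e1 ^+ 2 + e2 ^+ 2 + e3 ^+ 2))); last by ring.
rewrite (_ : (y * z) ^+ 2 * e0 ^+ 2 = (y * z) * (y * z * e0 ^+ 2)); last by ring.
apply: ler_wpM2l => //; apply: ler_pM => //; first exact: sqr_ge0.
by rewrite -!addrA lerDl !addr_ge0 // sqr_ge0.
Qed.

Lemma col_norm g : SO3 g -> g 0 0 ^+ 2 + g 1 0 ^+ 2 + g 2 0 ^+ 2 = 1.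
Proof.
move=> Sg; have := SO3_inner 0 0 (SO3_tr Sg).
by rewrite /inner sum3E !mxE eqxx -!expr2.
Qed.

Lemma cauchy2 (x y u v : R) : (x * u + y * v) ^+ 2 <=
  (x ^+ 2 + y ^+ 2) * (u ^+ 2 + v ^+ 2).
Proof. have := sqr_ge0 (x * v - y * u); nra. Qed.

(** The first entry of the direction of a_1 is constant along V_0 and V_1; along the
    other two directions its derivative is controlled by |a_1|, which is at least
    sqrt q. *)
Lemma short_axis q : 0 < q ->
  short (leaf q 0) (fun a => Num.sqrt (Num.sqrt q) * (a 0 0 / Num.sqrt (sqnorm a 0))).
Proof.
move=> q0 c t X vX.
have [s [g [e0 [e1 [e2 [e3 [s0 Sg ctE -> [dn da]]]]]]]] :=
  velocity_polar (ltW q0) (lexx 0) vX.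
have n0 : sqnorm (c t) 0 =
  s + q by rewrite ctE (sqnorm_polar _ (ltW q0) (lexx 0) s0 Sg) /sqlen /= addr0.
have n0_gt0 : 0 < sqnorm (c t) 0 by rewrite n0; lra.
have d0_gt0 : 0 < Num.sqrt (s + q) by rewrite sqrtr_gt0 -n0.
have d0' : Num.sqrt (sqnorm (c t) 0) != 0 by rewrite n0 gt_eqF.
exists (Num.sqrt (Num.sqrt q) * Num.sqrt s * (e2 * g 2 0 - e3 * g 1 0)).
  rewrite /comp; apply: (der_eq (derM (der_cst _ t) (derM da (derV (der_sqrt (dn
    0) n0_gt0) d0')))).
  rewrite n0 ctE mxE /vol /sqlen /= addr0; field.
  by rewrite gt_eqF.
rewrite !exprMn (sqr_sqrtr (sqrtr_ge0 q)) (sqr_sqrtr (ltW s0)) /vol addr0.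
rewrite -[_ * Num.sqrt s * Num.sqrt s]mulrA -[Num.sqrt s * _]expr2 (sqr_sqrtr
  (ltW s0)).
have c2 : (e2 * g 2 0 - e3 * g 1 0) ^+ 2 <= e0 ^+ 2 + e1 ^+ 2 + e2 ^+ 2 + e3 ^+ 2.
  have := cauchy2 e2 e3 (g 2 0) (- g 1 0); rewrite mulrN sqrrN.
  have := col_norm Sg; have := sqr_ge0 (g 0 0).
  have := sqr_ge0 e0; have := sqr_ge0 e1; have := sqr_ge0 e2; have := sqr_ge0 e3.
  nra.
apply: ler_pM => //; rewrite ?sqr_ge0 ?mulr_ge0 ?sqrtr_ge0 ?(ltW s0) //.
by apply: ler_wpM2r; [exact: ltW|rewrite ler_wsqrtr //; lra].
Qed.

Lemma cauchy3 (x y z u v w : R) : (x * u + y * v + z * w) ^+ 2 <=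
  (x ^+ 2 + y ^+ 2 + z ^+ 2) * (u ^+ 2 + v ^+ 2 + w ^+ 2).
Proof.
rewrite -subr_ge0 (_ : _ - _ =
  (x * v - y * u) ^+ 2 + (x * w - z * u) ^+ 2 + (y * w - z * v) ^+ 2).
  by rewrite !addr_ge0 // sqr_ge0.
by ring.
Qed.

(** The function w chi, where w is the first entry of the direction of a_1 and
    chi = (2/3) |a_3|^2 / sqrt |Phi| is close to the distance to the boundary. *)
Definition spike a : R := 2 / 3 * (sqnorm a 2 * a 0 0 / (Num.sqrt (sqnorm a 0) *
  Num.sqrt (Num.sqrt (sqnorm a 0) * Num.sqrt (sqnorm a 1) * Num.sqrt (sqnorm a 2)))).

Lemma spike_coef (x y z : R) : 0 < z -> z <= y -> y <= x ->
  0 <= 2 - z ^+ 2 * (x ^- 2 + y ^- 2 + z ^- 2) / 2 <= 3 / 2.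
Proof.
move=> z0 zy yx; have y0 := lt_le_trans z0 zy; have x0 := lt_le_trans y0 yx.
have q1 u : z <= u -> 0 < u -> 0 <= z ^+ 2 / u ^+ 2 <= 1.
  move=> zu u0; rewrite divr_ge0 ?sqr_ge0 //= ler_pdivrMr ?exprn_gt0 // mul1r.
  by rewrite ler_pXn2r // nnegrE ltW.
have /andP[? ?] := q1 _ zy y0; have /andP[? ?] := q1 _ (le_trans zy yx) x0.
have zz : z ^+ 2 / z ^+ 2 = 1 by rewrite mulfV // expf_neq0 // gt_eqF.
by rewrite !mulrDr zz; lra.
Qed.

(** In the frame the gradient has the three components D b w, |a_3|^2 |a_2| w'
    and |a_3|^3 w'', up to the factor 2 / (3 sqrt D), with D = |Phi|, 0 <= b <= 3/2
    and w^2 + w'^2 + w''^2 = 1. Each coefficient is at most (3/2) D. *)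
Lemma short_spike q r : 0 <= q -> 0 <= r -> short (leaf q r) spike.
Proof.
move=> q0 r0 c t X vX.
have [s [g [e0 [e1 [e2 [e3 [s0 Sg ctE -> [dn da]]]]]]]] := velocity_polar q0 r0 vX.
have n0 : sqnorm (c t) 0 = s + r + q by rewrite ctE sqnorm_polar.
have n1 : sqnorm (c t) 1 = s + r by rewrite ctE sqnorm_polar.
have n2 : sqnorm (c t) 2 = s by rewrite ctE sqnorm_polar.
have n0_gt0 : 0 < sqnorm (c t) 0 by rewrite n0; lra.
have n1_gt0 : 0 < sqnorm (c t) 1 by rewrite n1; lra.
have n2_gt0 : 0 < sqnorm (c t) 2 by rewrite n2.
have x_gt0 : 0 < Num.sqrt (s + r + q) by rewrite sqrtr_gt0; lra.
have y_gt0 : 0 < Num.sqrt (s + r) by rewrite sqrtr_gt0; lra.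
have z_gt0 : 0 < Num.sqrt s by rewrite sqrtr_gt0.
have D_gt0 : 0 < vol q r s := vol_gt0 q0 r0 s0.
have D_gt0' : 0 < Num.sqrt (sqnorm (c t) 0) * Num.sqrt (sqnorm (c t) 1) *
  Num.sqrt (sqnorm (c t) 2).
  by rewrite n0 n1 n2.
have W_gt0 : 0 < Num.sqrt (vol q r s) by rewrite sqrtr_gt0.
have den0 : Num.sqrt (sqnorm (c t) 0) * Num.sqrt (Num.sqrt (sqnorm (c t) 0) *
    Num.sqrt (sqnorm (c t) 1) * Num.sqrt (sqnorm (c t) 2)) != 0.
  by rewrite n0 n1 n2 mulf_neq0 // gt_eqF.
have yx : Num.sqrt (s + r) <= Num.sqrt (s + r + q) by rewrite ler_wsqrtr //; lra.
have zy : Num.sqrt s <= Num.sqrt (s + r) by rewrite ler_wsqrtr //; lra.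
have zE : Num.sqrt s ^+ 2 = s by rewrite sqr_sqrtr // ltW.
have DE : Num.sqrt (vol q r s) ^+ 2 = vol q r s by rewrite sqr_sqrtr // ltW.
have W'E : Num.sqrt (Num.sqrt (s + r + q) * Num.sqrt (s + r) * Num.sqrt s) =
  Num.sqrt (vol q r s) by [].
have volE : vol q r s = Num.sqrt (s + r + q) * Num.sqrt (s + r) * Num.sqrt s by [].
have a00 : c t 0 0 = - Num.sqrt (s + r + q) * g 0 0 by rewrite ctE mxE.
have p0 := der_sqrt (dn 0) n0_gt0; have p1 := der_sqrt (dn 1) n1_gt0.
have p2 := der_sqrt (dn 2) n2_gt0.
have dW := der_sqrt (derM (derM p0 p1) p2) D_gt0'.
have := derM (der_cst (2 / 3) t) (derM (derM (dn 2) da) (derV (derM p0 dW) den0)).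
rewrite !n0 !n1 !n2 W'E a00 => dspike.
set x := Num.sqrt (s + r + q) in x_gt0 yx dspike volE *.
set y := Num.sqrt (s + r) in y_gt0 yx zy dspike volE *.
set z := Num.sqrt s in z_gt0 zy zE dspike volE *.
set W := Num.sqrt (vol q r s) in W_gt0 DE dspike *.
pose b := 2 - z ^+ 2 * (x ^- 2 + y ^- 2 + z ^- 2) / 2.
exists (2 / 3 * (e0 * (vol q r s * b * g 0 0) + e2 * (z ^+ 2 * y * g 2 0) + e3 *
  - (z ^+ 3 * g 1 0)) / W).
  apply: (der_eq dspike).
  have W0 : W != 0 by rewrite gt_eqF.
  have x0 : x != 0 by rewrite gt_eqF. have y0 : y != 0 by rewrite gt_eqF.
    have z0 : z != 0 by rewrite gt_eqF.
  (* Eliminating x makes the remaining variables algebraically independent. *)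
  have xE : x = W ^+ 2 / (y * z) by rewrite DE volE -[x * y * z]mulrA mulfK //
    mulf_neq0.
  by clearbody x y z W; rewrite /b -DE -zE xE; field; rewrite ?y0 ?z0 ?W0.
rewrite exprMn exprVn DE ler_pdivrMr //.
have /andP[b0 b1] : 0 <= b <= 3 / 2 by exact: spike_coef.
clearbody b x y z W; rewrite volE in D_gt0 *.
set D := x * y * z in D_gt0 *; have Dxyz : D = x * y * z by []; clearbody D.
have A2 : (D * b * g 0 0) ^+ 2 <= 9 / 4 * D ^+ 2 * g 0 0 ^+ 2.
  rewrite !exprMn; apply: ler_wpM2r; first exact: sqr_ge0.
  rewrite mulrC; apply: ler_wpM2r; first exact: sqr_ge0.
  by nra.
have zzyD : z ^+ 2 * y <= D.
  by rewrite Dxyz expr2 -[x * y * z]mulrA [y * z]mulrC mulrA ler_wpM2r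
    ?ler_wpM2r ?(le_trans zy yx) ?(ltW y_gt0) ?(ltW z_gt0).
have zzzD : z ^+ 3 <= D.
  apply: le_trans zzyD; rewrite exprSr; apply: ler_wpM2l => //; exact: sqr_ge0.
have B2 : (z ^+ 2 * y * g 2 0) ^+ 2 <= D ^+ 2 * g 2 0 ^+ 2.
  rewrite exprMn; apply: ler_wpM2r; first exact: sqr_ge0.
  by rewrite ler_pXn2r // nnegrE ?mulr_ge0 ?exprn_ge0 // ltW.
have C2 : (- (z ^+ 3 * g 1 0)) ^+ 2 <= D ^+ 2 * g 1 0 ^+ 2.
  rewrite sqrrN exprMn; apply: ler_wpM2r; first exact: sqr_ge0.
  by rewrite ler_pXn2r // nnegrE ?exprn_ge0 // ltW.
have S : (D * b * g 0 0) ^+ 2 + (z ^+ 2 * y * g 2 0) ^+ 2 + (- (z ^+ 3 * g 1 0))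
  ^+ 2 <= 9 / 4 * D ^+ 2.
  have := col_norm Sg; have := sqr_ge0 D; have := sqr_ge0 (g 1 0); have :=
    sqr_ge0 (g 2 0).
  by nra.
have := cauchy3 e0 e2 e3 (D * b * g 0 0) (z ^+ 2 * y * g 2 0) (- (z ^+ 3 * g 1 0)).
set P := (_ + _ + _) ^+ 2; set Q := _ * (_ + _ + _) => PQ.
have QD : Q <= (e0 ^+ 2 + e1 ^+ 2 + e2 ^+ 2 + e3 ^+ 2) * (9 / 4 * D ^+ 2).
  apply: ler_pM => //; rewrite ?addr_ge0 ?sqr_ge0 //.
  by have := sqr_ge0 e1; lra.
rewrite exprMn -/P; have {}PQ := le_trans PQ QD.
rewrite (_ : D * _ * D = 4 / 9 * ((e0 ^+ 2 + e1 ^+ 2 + e2 ^+ 2 + e3 ^+ 2) * (9 /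
  4 * D ^+ 2))); last by field.
by rewrite (_ : (2 / 3) ^+ 2 = 4 / 9 :> R); [rewrite ler_pM2l //; lra | field].
Qed.

(** * Lengths of curves *)

(** Both h - f and h + f are nondecreasing. *)
Lemma derivative_le (f h f' h' : R -> R) (a b : R) : a <= b ->
  (forall u, a <= u <= b -> [/\ is_derive u (1 : R) f (f' u),
     is_derive u (1 : R) h (h' u), 0 <= h' u & f' u ^+ 2 <= h' u ^+ 2]) ->
  `|f b - f a| <= h b - h a.
Proof.
move=> ab fh.
have f'h' u : a <= u <= b -> - h' u <= f' u <= h' u.
  by move=> /fh[_ _ h0]; rewrite -ler_norml -(ler_sqr (normr_ge0 _) h0)
    real_normK // num_real.
have mvt (phi phi' : R -> R) : (forall u, a <= u <= b -> is_derive u (1 :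
  R) phi (phi' u)) ->
    (forall u, a <= u <= b -> 0 <= phi' u) -> phi a <= phi b.
  move=> dphi phi'0; rewrite -subr_ge0.
  have [u uab ->] : exists2 u, u \in `[a, b] & phi b - phi a = phi' u * (b - a).
    apply: MVT_segment => // [u|].
      by rewrite in_itv /= => /andP[/ltW au /ltW ub]; apply: dphi; rewrite au.
    apply: derivable_within_continuous => u.
    by rewrite in_itv /= => /dphi; case.
  by rewrite mulr_ge0 ?subr_ge0 // phi'0 // -in_itv.
have Hp : h a + f a <= h b + f b.
  apply: (mvt (fun u => h u + f u) (fun u => h' u + f' u)) => u uab.
    by have [df dh _ _] := fh u uab; exact: derD.
  by have /andP[] := f'h' u uab; lra.
have Hm : h a - f a <= h b - f b.
  apply: (mvt (fun u => h u - f u) (fun u => h' u - f' u)) => u uab.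
    by have [df dh _ _] := fh u uab; exact: derD dh (derN df).
  by have /andP[] := f'h' u uab; lra.
by rewrite ler_norml; apply/andP; split; lra.
Qed.

Lemma speed_bound (N : set 'M[R]_3) f (c : R -> 'M[R]_3) (h h' : R -> R) (a b : R) :
  short N f -> a <= b ->
  (forall u, a <= u <= b -> is_derive u (1 : R) h (h' u) /\ 0 <= h' u /\
     exists2 X, velocity N c u X & metric (c u) X X <= h' u ^+ 2) ->
  `|f (c b) - f (c a)| <= h b - h a.
Proof.
move=> sf ab cH.
pose f' u := 'D_1 (f \o c) u.
apply: (@derivative_le (f \o c) h f' h') => // u uab.
have [dh [h'0 [X vX Xh']]] := cH u uab.
have [y dy yX] := sf _ _ _ vX.
have fE : f' u = y by exact: dy.(derive_val).
by rewrite fE; split=> //; exact: le_trans yX Xh'.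
Qed.

Lemma metric_entries q r (c : R -> 'M[R]_3) (t : R) X s g (P := X *m (c t)^T) :
  velocity (leaf q r) c t X -> c t = polar q r s g -> SO3 g ->
  metric (c t) X X = (P 0 0 ^+ 2 + P 2 1 ^+ 2 + P 0 2 ^+ 2 + P 1 0 ^+ 2) / vol q r s.
Proof.
move=> vX ctE Sg; rewrite (velocity_metric vX) -/P.
rewrite ctE Phi_polar ((SO3P g).1 Sg).2 mulr1 invrN opprK mulrC.
by [].
Qed.

(** The radial curve, parametrized by s = |a_3|^2, has speed 1 / (2 sqrt |Phi|); a
    primitive of any larger function bounds the variation of f. *)
Lemma radial_bound q r f g (h h' : R -> R) (a b : R) : 0 <= q -> 0 <= r -> SO3 g ->
  short (leaf q r) f -> 0 < a -> a <= b ->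
  (forall u : R, 0 < u -> [/\ is_derive u (1 : R) h (h' u), 0 <= h' u &
     1 <= 4 * vol q r u * h' u ^+ 2]) ->
  `|f (polar q r b g) - f (polar q r a g)| <= h b - h a.
Proof.
move=> q0 r0 Sg sf a0 ab hH.
apply: (@speed_bound _ _ (fun u => polar q r u g) h h' a b sf ab) => u /andP[au _].
have u0 := lt_le_trans a0 au.
have [dh h'0 hvol] := hH u u0; split=> //; split=> //.
have [X [vX XE]] := radial_velocity q0 r0 u0 Sg.
exists X => //; rewrite (metric_entries vX erefl Sg) !XE /= !mulr0 mulr1.
rewrite ler_pdivrMr; last exact: vol_gt0.
rewrite expr0n /= !addr0 [2^-1 ^+ 2](_ : _ = 4^-1) ?ler_pdivrMl //; last by field.
lra.
Qed.

(** The speed of the turn about row j is |a_(j+1)| |a_(j+2)| / sqrt |Phi|. *)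
Lemma turn_bound q r s g f j (u v sigma : R) : 0 <= q -> 0 <= r -> 0 < s -> SO3 g ->
  short (leaf q r) f -> 0 <= sigma ->
  sqlen q r s (j + 1) * sqlen q r s (j + 2) <= sigma ^+ 2 * vol q r s ->
  `|f (turn q r s g j v) - f (turn q r s g j u)| <= sigma * `|v - u|.
Proof.
move=> q0 r0 s0 Sg sf sigma0 Hs.
wlog uv : u v / u <= v.
  move=> H; have [/H//|/ltW/H] := leP u v.
  by rewrite distrC [`|u - v|]distrC.
rewrite [`|v - u|]ger0_norm ?subr_ge0 // mulrBr.
apply: (@speed_bound _ _ (turn q r s g j) (fun w => sigma * w) (fun=>
  sigma) u v sf uv) => w _.
split.
  by apply: (der_eq (derM (der_cst sigma w) (is_derive_id _ _)));
    rewrite mul0r add0r mulr1.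
split=> //; have [X [vX XE]] := turn_velocity j w q0 r0 s0 Sg.
exists X => //; rewrite (metric_entries vX erefl (SO3_mul (rotmx_SO3 _ _) Sg)) !XE.
rewrite ler_pdivrMr; last exact: vol_gt0.
apply: le_trans Hs.
have sqE i : Num.sqrt (sqlen q r s i) ^+ 2 =
  sqlen q r s i by rewrite sqr_sqrtr // ltW // sqlen_gt0.
rewrite !exprMn !sqE.
by move: j {X vX XE}; apply: all3P; rewrite !mxE !ord3E /=; rewrite le_eqVlt;
  apply/orP; left; apply/eqP; ring.
Qed.

(** * Compact parts of a leaf *)

Lemma continuous_entry i j : continuous (fun a : 'M[R]_3 => a i j).
Proof. exact: coord_continuous. Qed.

Lemma continuous_add (f g : 'M[R]_3 -> R) : continuous f -> continuous g ->
  continuous (fun a => f a + g a).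
Proof. by move=> cf cg a; exact: cvgD (cf a) (cg a). Qed.

Lemma continuous_sub (f g : 'M[R]_3 -> R) : continuous f -> continuous g ->
  continuous (fun a => f a - g a).
Proof. by move=> cf cg a; exact: cvgB (cf a) (cg a). Qed.

Lemma continuous_mul (f g : 'M[R]_3 -> R) : continuous f -> continuous g ->
  continuous (fun a => f a * g a).
Proof. by move=> cf cg a; exact: cvgM (cf a) (cg a). Qed.

Lemma continuous_inner i j : continuous (fun a : 'M[R]_3 =>
  inner (row i a) (row j a)).
Proof.
rewrite (_ : (fun _ => _) = fun a : 'M[R]_3 =>
  a i 0 * a j 0 + a i 1 * a j 1 + a i 2 * a j 2); last first.
  by apply/funext => a; rewrite /inner sum3E !mxE.
have cM k l m p := continuous_mul (@continuous_entry k l) (@continuous_entry m p).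
exact: continuous_add (continuous_add (cM _ _ _ _) (cM _ _ _ _)) (cM _ _ _ _).
Qed.

Lemma continuous_Phi : continuous (Phi : 'M[R]_3 -> R).
Proof.
rewrite (_ : Phi = fun a : 'M[R]_3 => a 0 0 * (a 1 1 * a 2 2 - a 1 2 * a 2 1)
  + a 0 1 * (a 1 2 * a 2 0 - a 1 0 * a 2 2)
  + a 0 2 * (a 1 0 * a 2 1 - a 1 1 * a 2 0)); last by apply/funext => a; rewrite PhiE.
have cM k l m p := continuous_mul (@continuous_entry k l) (@continuous_entry m p).
have cB k l m p k' l' m' p' := continuous_sub (cM k l m p) (cM k' l' m' p').
have c3 k l k1 l1 m1 p1 k2 l2 m2 p2 :=
  continuous_mul (@continuous_entry k l) (cB k1 l1 m1 p1 k2 l2 m2 p2).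
exact: continuous_add (continuous_add (c3 _ _ _ _ _ _ _ _ _ _) (c3 _ _ _ _ _ _ _
  _ _ _)) (c3 _ _ _ _ _ _ _ _ _ _).
Qed.

(** Both norms are the maximum of the absolute values of the same entries. *)
Lemma vec_mx_continuous : continuous (vec_mx : 'rV[R]_(3 * 3) -> 'M[R]_3).
Proof.
move=> v; have FF : Filter (nbhs v) by exact: nbhs_filter.
apply: (cvgrPdist_lt (F := nbhs v)
  (vec_mx : 'rV[R]_(3 * 3) -> 'M[R]_3) (vec_mx v)).2 => e e0; near=> w.
rewrite -linearB /=; apply: le_lt_trans (_ : `|v - w| < e).
  rewrite [leLHS]/Num.Def.normr/= mx_normrE; apply: bigmax_le => // -[i j] _ /=.
  rewrite mxE [leRHS]/Num.Def.normr/= mx_normrE.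
  exact: (le_bigmax _ (fun k => `|(v - w) k.1 k.2|) (0, mxvec_index i j)).
by near: w; exact: cvgr_dist_lt.
Unshelve. all: by end_near. Qed.

Lemma mx_bounded_closed_compact (A : set 'M[R]_3) (B : R) :
  closed A -> (forall a, A a -> forall i j, `|a i j| <= B) -> compact A.
Proof.
move=> cA bA; rewrite (_ : A = vec_mx @` (vec_mx @^-1` A)); last first.
  apply/seteqP; split=> [a Aa|_ [v Av <-]//].
  by exists (mxvec a); rewrite /= mxvecK.
apply: continuous_compact; first exact/continuous_subspaceT/vec_mx_continuous.
apply: bounded_closed_compact; last first.
  exact: ((continuous_closedP _).1 vec_mx_continuous).
exists (Num.max 0 B); split; first exact: num_real.
move=> x; rewrite gt_max => /andP[x0 /ltW Bx] v /bA bv.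
rewrite /= [leLHS]/Num.Def.normr /= mx_normrE; apply: bigmax_le =>
  [|[i k] _ /=]; first exact: ltW.
rewrite (ord1 i); have [[j l] ->] : exists jl, k = mxvec_index jl.1 jl.2.
  by case/mxvec_indexP: k => j l; exists (j, l).
by apply: le_trans Bx; have := bv j l; rewrite mxE.
Qed.

(** Away from |a_3| = 0 the strict inequality Phi < 0 can be replaced by Phi <= 0,
    because Phi^2 is the product of the squared lengths of the rows. *)
Lemma compact_slab q r (eps B : R) : 0 <= q -> 0 <= r -> 0 < eps ->
  compact [set a | [/\ leaf q r a, eps <= sqnorm a 2 & sqnorm a 0 <= B]].
Proof.
move=> q0 r0 eps0.
have E : [set a | [/\ leaf q r a, eps <= sqnorm a 2 & sqnorm a 0 <= B]] =
  \bigcap_(ij in [set ij : 'I_3 * 'I_3 | ij.1 != ij.2])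
      (fun a => inner (row ij.1 a) (row ij.2 a)) @^-1` [set 0] `&`
  ((fun a => sqnorm a 0 - sqnorm a 1) @^-1` [set q] `&`
   (fun a => sqnorm a 1 - sqnorm a 2) @^-1` [set r]) `&`
  (Phi @^-1` [set x | x <= 0] `&` ((sqnorm^~ 2) @^-1` [set x | eps <= x] `&`
   (sqnorm^~ 0) @^-1` [set x | x <= B])).
  apply/seteqP; split=> a /=.
    move=> [[ort eq er Pa] h2 h0]; split; last by split=> //; exact: ltW.
    by split=> // -[i j] /= /ort.
  move=> [[ort [eq er]] [Pa [h2 h0]]]; split=> //; split=> //.
    by move=> i j ij; exact: (ort (i, j)).
  rewrite lt_neqAle Pa andbT -sqrf_eq0 gram_Phi PhiE !gram_entry.
  rewrite (ort (0, 1)) // (ort (0, 2)) // (ort (1, 0)) // (ort (1, 2)) //.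
  rewrite !mul0r !subr0 !addr0 gt_eqF // !mulr_gt0 //;
    rewrite /sqnorm in eq er h2; lra.
have cn i j : continuous (fun a : 'M[R]_3 => sqnorm a i - sqnorm a j).
  exact: continuous_sub (@continuous_inner i i) (@continuous_inner j j).
have pre (f : 'M[R]_3 -> R) D (cf : continuous f) : closed D ->
  closed (f @^-1` D) := (continuous_closedP _).1 cf D.
apply: (@mx_bounded_closed_compact _ (1 + `|B|)).
  rewrite E; apply: closedI.
    apply: closedI; last apply: closedI.
    - by apply: closed_bigI => -[i j] _; apply:
      (pre _ _ (@continuous_inner i j)); exact: closed_eq.
    - by apply: (pre _ _ (@cn _ _)); exact: closed_eq.
    - by apply: (pre _ _ (@cn _ _)); exact: closed_eq.
  apply: closedI; last apply: closedI.
  - by apply: (pre _ _ (@continuous_Phi)); exact: closed_le.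
  - by apply: (pre _ _ (@continuous_inner _ _)); exact: closed_ge.
  - by apply: (pre _ _ (@continuous_inner _ _)); exact: closed_le.
move=> a [[_ eq er _] h2 h0] i j.
have nB : sqnorm a i <= `|B|.
  apply: le_trans (ler_norm B); apply: le_trans h0.
  by move: i; apply: all3P; rewrite /sqnorm; lra.
have aij : `|a i j| ^+ 2 <= `|B|.
  apply: le_trans nB; rewrite real_normK ?num_real // /sqnorm /inner.
  rewrite (bigD1 j) //= !mxE expr2 lerDl; apply: sumr_ge0 => k _.
  by rewrite mxE -expr2 sqr_ge0.
have := normr_ge0 (a i j); have := normr_ge0 B; nra.
Qed.

(** * Distance to the missing boundary *)

(** The squared length of the last row has a positive minimum on a compact subset
    of the leaf, and takes all small values on the radial segment. *)
Lemma escape_radial q r (A : set 'M[R]_3) (s0 : R) g : 0 <= q -> 0 <= r -> SO3 g ->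
  0 < s0 -> (forall s, 0 < s -> s <= s0 -> A (polar q r s g)) ->
  ~ relatively_compact (leaf q r) A.
Proof.
move=> q0 r0 Sg s00 HA [K [cK KN AK]].
have K0 : K !=set0 by exists (polar q r s0 g); apply: AK; apply: HA.
have [z /set_mem Kz zmin] := compact_EVT_min K0 cK
   (continuous_subspaceT (@continuous_inner 2 2)).
have [s [h [spos Sh zE]]] := leaf_polar (KN _ Kz) q0 r0.
pose s1 := Num.min s0 (s / 2).
have s1pos : 0 < s1 by rewrite lt_min s00 divr_gt0.
have /zmin : polar q r s1 g \in K.
  by apply/mem_set/AK/HA => //; rewrite ge_min lexx.
rewrite -/(sqnorm _ _) -[X in _ <= X]/(sqnorm _ _) zE !sqnorm_polar // /sqlen /=.
rewrite le_min => /andP[_]; lra.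
Qed.

(** short_norm bounds |a_1| on the ball; if |a_3| were also bounded below there, then
    the ball would lie in a compact slab. *)
Lemma escape_deep q r x rho (eps : R) : 0 <= q -> 0 <= r -> 0 < eps ->
  ~ relatively_compact (leaf q r) (short_ball (leaf q r) x rho) ->
  exists2 z, short_ball (leaf q r) x rho z & sqnorm z 2 < eps.
Proof.
move=> q0 r0 eps0 ncx; apply: contrapT => noz; apply: ncx.
(* short_norm bounds the fourth root of the squared length of the first row by b. *)
pose b := Num.sqrt (Num.sqrt (sqnorm x 0)) + rho / 2.
exists [set a | [/\ leaf q r a, eps <= sqnorm a 2 & sqnorm a 0 <= b ^+ 4]]; split.
- exact: compact_slab.
- by move=> a [].
move=> z bz; have [Nz zs] := bz; split=> //.
  by rewrite leNgt; apply/negP => zeps; apply: noz; exists z.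
have := zs _ (short_norm q0 r0); rewrite ler_norml => /andP[_].
set u := Num.sqrt (Num.sqrt (sqnorm z 0)) => ub.
have u0 : 0 <= u by rewrite sqrtr_ge0.
have ub' : u <= b by rewrite /b; lra.
have z0 : 0 <= sqnorm z 0 by apply: sumr_ge0 => k _; exact: sqr_ge0.
have -> : sqnorm z 0 = u ^+ 4.
  by rewrite (exprM u 2 2) sqr_sqrtr ?sqrtr_ge0 // sqr_sqrtr.
by rewrite lerXn2r // nnegrE; lra.
Qed.

Lemma polarE q r s g j k : polar q r s g j k = - Num.sqrt (sqlen q r s j) * g j k.
Proof. by rewrite mxE. Qed.

Lemma rotmx_pi : rotmx 2 pi 0 0 = - 1 :> R.
Proof.
by rewrite rotmxE cospi sinpi mul0r !mxE sum3E !mxE !ord3E /=; ring.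
Qed.

Lemma SO3_1 : SO3 (1%:M : 'M[R]_3).
Proof. by split; rewrite ?det1 // trmx1 mulmx1. Qed.

Lemma short_ball_polar q r (s0 : R) g (h h' : R -> R) : 0 <= q -> 0 <= r -> SO3 g ->
  0 < s0 -> (forall s, 0 < s -> 0 <= h s) ->
  (forall u : R, 0 < u -> [/\ is_derive u (1 : R) h (h' u), 0 <= h' u &
     1 <= 4 * vol q r u * h' u ^+ 2]) ->
  ~ relatively_compact (leaf q r) (short_ball (leaf q r) (polar q r s0 g) (h s0)).
Proof.
move=> q0 r0 Sg s00 h0 hH; apply: (@escape_radial _ _ _ s0 g) => // s spos ss0; split.
  exact: polar_leaf.
move=> f sf; rewrite distrC; apply: le_trans (radial_bound q0 r0 Sg sf spos ss0 hH) _.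
by rewrite gerBl h0.
Qed.

(** * Leaves of type 1 are wide *)

(** Two points with opposite a_1 are separated by the fixed amount 2 q^(1/4) by
    short_axis, while their distance to the boundary is O(s^(1/2)). *)
Lemma wide_type1 q M : 0 < q -> 0 < M -> wide (leaf q 0) M.
Proof.
move=> q0 M0; have q0' := ltW q0; have k0 :
  0 < Num.sqrt (Num.sqrt q) by rewrite !sqrtr_gt0.
set k := Num.sqrt (Num.sqrt q) in k0.
have kE : k ^+ 2 = Num.sqrt q by rewrite sqr_sqrtr // sqrtr_ge0.
(* The solution of M * h s0 = 2 * k, for the bound h on the distance to the boundary. *)
pose s0 : R := (2 * k ^+ 2 / M) ^+ 2.
have s00 : 0 < s0 by rewrite exprn_gt0 // divr_gt0 // mulr_gt0 // exprn_gt0.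
pose h (u : R) := Num.sqrt u / k; pose h' (u : R) := (2 * Num.sqrt u)^-1 / k.
have h0 s : 0 < s -> 0 <= h s by rewrite divr_ge0 ?sqrtr_ge0 // ltW.
have hH (u : R) : 0 < u -> [/\ is_derive u (1 : R) h (h' u), 0 <= h' u &
     1 <= 4 * vol q 0 u * h' u ^+ 2].
  move=> u0; have su0 : 0 < Num.sqrt u by rewrite sqrtr_gt0.
  split.
  - by apply: (der_eq (derM (is_derive1_sqrt u0) (der_cst k^-1 u)));
    rewrite mulr0 addr0.
  - by rewrite /h' divr_ge0 ?invr_ge0 ?mulr_ge0 // ltW.
  rewrite /vol addr0 /h' expr_div_n exprVn exprMn kE.
  have qu : Num.sqrt q <= Num.sqrt (u + q) by rewrite ler_wsqrtr //; lra.
  have sq0 : 0 < Num.sqrt q by rewrite sqrtr_gt0.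
  rewrite [X in 1 <= X](_ : _ = Num.sqrt (u + q) / Num.sqrt q);
    first by rewrite ler_pdivlMr ?mul1r.
  by field; rewrite !gt_eqF.
have S2 : SO3 (rotmx 2 pi : 'M[R]_3) by exact: rotmx_SO3.
exists (polar q 0 s0 (rotmx 2 pi)), (polar q 0 s0 1%:M), (h s0); split.
- by split; apply: polar_leaf => //; exact: SO3_1.
- by rewrite divr_gt0 // sqrtr_gt0.
- exact: short_ball_polar hH.
- by apply: short_ball_polar hH => //; exact: SO3_1.
exists (fun a => Num.sqrt (Num.sqrt q) * (a 0 0 / Num.sqrt (sqnorm a 0)));
  first exact: short_axis.
rewrite !sqnorm_polar //; last exact: SO3_1.
rewrite !polarE rotmx_pi [1%:M _ _]mxE /sqlen /= addr0.
have sq0 : 0 < Num.sqrt (s0 + q) by rewrite sqrtr_gt0 addr_gt0.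
rewrite -/k /h /s0 sqrtr_sqr ger0_norm;
  last by rewrite divr_ge0 ?mulr_ge0 ?exprn_ge0 // ltW.
rewrite le_eqVlt; apply/orP; left; apply/eqP; field.
by rewrite !gt_eqF.
Qed.

(** * Leaves of type 2 are wide *)

(** An upper bound for the distance to the boundary at |a_3|^2 = u, obtained by
    integrating 1 / (2 (u r (r + q))^(1/4)), a bound for the radial speed. *)
Definition radius q r (u : R) : R :=
  2 / 3 * (Num.sqrt u * Num.sqrt (Num.sqrt u)) / Num.sqrt (Num.sqrt (r * (r + q))).

Lemma radius_ge0 q r u : 0 <= radius q r u.
Proof. by rewrite divr_ge0 ?sqrtr_ge0 // !mulr_ge0 ?sqrtr_ge0 // invr_ge0. Qed.

Lemma radius_speed q r (u : R) (k := Num.sqrt (Num.sqrt (r * (r + q)))) :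
  0 <= q -> 0 < r -> 0 < u ->
  [/\ is_derive u (1 : R) (radius q r) (2 * Num.sqrt (Num.sqrt u) * k)^-1,
   0 <= (2 * Num.sqrt (Num.sqrt u) * k)^-1 &
   1 <= 4 * vol q r u * (2 * Num.sqrt (Num.sqrt u) * k)^-1 ^+ 2].
Proof.
move=> q0 r0 u0.
have rq0 : 0 < r * (r + q) by rewrite mulr_gt0 // ltr_wpDr.
have k0 : 0 < k by rewrite !sqrtr_gt0.
have kE : k ^+ 2 = Num.sqrt (r * (r + q)) by rewrite sqr_sqrtr // sqrtr_ge0.
have su0 : 0 < Num.sqrt u by rewrite sqrtr_gt0.
have w0 : 0 < Num.sqrt (Num.sqrt u) by rewrite sqrtr_gt0.
have wE : Num.sqrt (Num.sqrt u) ^+ 2 = Num.sqrt u by rewrite sqr_sqrtr // ltW.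
have du := is_derive1_sqrt u0.
split.
- apply: (der_eq (derM (derM (der_cst (2 / 3) u) (derM du (der_sqrt du su0)))
  (der_cst k^-1 u))).
  move: w0 wE; set w := Num.sqrt (Num.sqrt u) => w0 wE; rewrite -wE.
  by field; rewrite !gt_eqF.
- by rewrite invr_ge0 !mulr_ge0 // ltW.
rewrite exprVn !exprMn wE kE.
have vu : vol q r u = Num.sqrt ((u + r) * (u + r + q)) * Num.sqrt u.
  by rewrite sqrtrM /vol; [ring | lra].
have S0 : 0 < Num.sqrt (r * (r + q)) by rewrite sqrtr_gt0.
rewrite vu [X in 1 <= X](_ : _ =
  Num.sqrt ((u + r) * (u + r + q)) / Num.sqrt (r * (r + q))); last first.
  by field; rewrite !gt_eqF.
rewrite ler_pdivlMr // mul1r ler_wsqrtr //; apply: ler_pM; lra.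
Qed.

(** For s small, spike separates two points with opposite a_1 by almost twice their
    distance to the boundary; s = r / 3 is small enough for the factor 3/2. *)
Lemma wide_type2 q r : 0 <= q -> 0 < r -> wide (leaf q r) (3 / 2).
Proof.
move=> q0 r0; have r0' := ltW r0.
set s0 : R := r / 3; have s00 : 0 < s0 by rewrite divr_gt0.
have S2 : SO3 (rotmx 2 pi : 'M[R]_3) by exact: rotmx_SO3.
have hH u (u0 : 0 < u) := radius_speed q0 r0 u0.
have rq0 : 0 < r * (r + q) by rewrite mulr_gt0 // ltr_wpDr.
have k0 : 0 < Num.sqrt (Num.sqrt (r * (r + q))) by rewrite !sqrtr_gt0.
exists (polar q r s0 (rotmx 2 pi)), (polar q r s0 1%:M), (radius q r s0); split.
- by split; apply: polar_leaf => //; exact: SO3_1.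
- by rewrite divr_gt0 // !mulr_gt0 ?invr_gt0 ?sqrtr_gt0 // sqrtr_gt0.
- by apply: short_ball_polar hH => // s _; exact: radius_ge0.
- by apply: short_ball_polar hH => //; [exact: SO3_1|move=> s _; exact: radius_ge0].
exists spike; first exact: short_spike.
rewrite /spike !sqnorm_polar //; try exact: SO3_1.
rewrite !polarE rotmx_pi [1%:M _ _]mxE /sqlen /= -/(vol q r s0).
have D0 : 0 < vol q r s0 by exact: vol_gt0.
have W0 : 0 < Num.sqrt (vol q r s0) by rewrite sqrtr_gt0.
have x0 : 0 < Num.sqrt (s0 + r + q) by rewrite sqrtr_gt0; lra.
have su0 : 0 < Num.sqrt s0 by rewrite sqrtr_gt0.
have w0 : 0 < Num.sqrt (Num.sqrt s0) by rewrite sqrtr_gt0.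
rewrite [X in _ <= X](_ : _ = 4 / 3 * s0 / Num.sqrt (vol q r s0)); last first.
  by field; rewrite !gt_eqF.
rewrite /radius; set k := Num.sqrt _ in k0 *.
set w := Num.sqrt (Num.sqrt s0) in w0 *; set W := Num.sqrt (vol _ _ _) in W0 *.
have wE : w ^+ 4 = s0 by rewrite (exprM w 2 2) !sqr_sqrtr // ltW.
have w2E : w ^+ 2 = Num.sqrt s0 by rewrite sqr_sqrtr // ltW.
have kE : k ^+ 4 = r * (r + q) by rewrite (exprM k 2 2) !sqr_sqrtr ?sqrtr_ge0 // ltW.
have WE : W ^+ 4 = s0 * (s0 + r) * (s0 + r + q).
  rewrite (exprM W 2 2) sqr_sqrtr ?(ltW D0) // /vol !exprMn !sqr_sqrtr; [ring|lra..].
have WkW : 3 / 4 * W <= k * w.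
  rewrite -(@ler_pXn2r _ 4) // ?nnegrE; try by rewrite ?mulr_ge0 // ltW.
  rewrite !exprMn WE kE wE /s0; nra.
rewrite -w2E -{1}wE.
rewrite (_ : 3 / 2 * _ = w ^+ 3 / k); last by field; rewrite gt_eqF.
rewrite ler_pdivrMr // mulrAC ler_pdivlMr //.
rewrite (_ : 4 / 3 * w ^+ 4 * k = 4 / 3 * w ^+ 3 * (k * w)); last by ring.
rewrite (_ : w ^+ 3 * W = 4 / 3 * w ^+ 3 * (3 / 4 * W)); last by field.
by apply: ler_wpM2l => //; rewrite mulr_ge0 // exprn_ge0 // ltW.
Qed.

(** * Leaves of type 2 are not wider *)

Lemma angle_exists (x y : R) : x ^+ 2 + y ^+ 2 = 1 ->
  exists theta, [/\ `|theta| <= pi, cos theta = x & sin theta = y].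
Proof.
move=> xy; have x1 : -1 <= x <= 1 by have := sqr_ge0 y; nra.
have yE : Num.sqrt (1 - x ^+ 2) = `|y| by rewrite -xy addrC addKr sqrtr_sqr.
have a0 := acos_ge0 x1; have api := acos_lepi x1.
have [y0|/ltW y0] := leP 0 y.
  exists (acos x); split; [by rewrite ger0_norm|exact: acosK|].
  by rewrite sin_acos // yE ger0_norm.
exists (- acos x); split; [by rewrite normrN ger0_norm|by rewrite cosN acosK|].
by rewrite sinN sin_acos // yE ler0_norm // opprK.
Qed.

Lemma rotmx0E (u : R) : rotmx 0 u = mx3 1 0 0 0 (cos u) (- sin u) 0 (sin u) (cos u).
Proof.
by apply/matrixP; do 2 apply: all3P; rewrite rotmxE !mxE sum3E !mxE !ord3E /=; ring.
Qed.

Lemma rotmx1E (u : R) : rotmx 1 u = mx3 (cos u) 0 (sin u) 0 1 0 (- sin u) 0 (cos u).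
Proof.
by apply/matrixP; do 2 apply: all3P; rewrite rotmxE !mxE sum3E !mxE !ord3E /=; ring.
Qed.

(** Only turns about the axes 0 and 1 occur: these are the ones that become short
    near the boundary in type 2. *)
Lemma euler_angles g : SO3 g -> exists alpha beta gamma : R,
  [/\ `|alpha| <= pi, `|beta| <= pi, `|gamma| <= pi &
      g = rotmx 0 alpha *m (rotmx 1 beta *m rotmx 0 gamma)].
Proof.
move=> Sg; have := col_norm Sg => n1.
pose m := Num.sqrt (g 1 0 ^+ 2 + g 2 0 ^+ 2).
have mE : m ^+ 2 = g 1 0 ^+ 2 + g 2 0 ^+ 2 by rewrite sqr_sqrtr // addr_ge0 //
  sqr_ge0.
have [beta [betapi cb sb]] : exists theta, [/\ `|theta| <= pi, cos theta =
  g 0 0 & sin theta = m].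
  by apply: angle_exists; rewrite mE addrA.
have [alpha [alphapi ca sa]] : exists theta, [/\ `|theta| <= pi,
    g 1 0 = m * sin theta & g 2 0 = - (m * cos theta)].
  have [m0|m0] := eqVneq m 0.
    exists 0; rewrite normr0 pi_ge0 m0 !mul0r oppr0.
    by move: mE; rewrite m0 expr0n /= => /esym/eqP;
      rewrite paddr_eq0 ?sqr_ge0 // !sqrf_eq0 => /andP[/eqP -> /eqP ->].
  have [theta [tpi ct st]] : exists theta, [/\ `|theta| <= pi,
      cos theta = - (g 2 0 / m) & sin theta = g 1 0 / m].
    apply: angle_exists; rewrite sqrrN !expr_div_n -mulrDl addrC -mE mulfV //.
    by rewrite expf_neq0.
  exists theta; split=> //; rewrite ?ct ?st; by field.
(* h and g have the same first column, so k fixes the first basis vector. *)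
pose h := rotmx 0 alpha *m rotmx 1 beta.
have Sh : SO3 h by exact: SO3_mul (rotmx_SO3 _ _) (rotmx_SO3 _ _).
pose k := h^T *m g; have Sk : SO3 k by exact: SO3_mul (SO3_tr Sh) Sg.
have gE : g = h *m k by rewrite mulmxA Sh.1 mul1mx.
have hcol i : h i 0 = g i 0.
  rewrite /h rotmx0E rotmx1E; move: i; apply: all3P; rewrite !mxE sum3E !mxE /=
    ?cb ?sb ?ca ?sa; ring.
have kcol i : k i 0 = (i == 0)%:R.
  rewrite mxE; under eq_bigr => l _ do rewrite -hcol.
  by have := mulmx1C Sh.1 => /matrixP/(_ i 0); rewrite !mxE.
have k00 : k 0 0 = 1 by rewrite kcol eqxx.
have k10 : k 1 0 = 0 by rewrite kcol.
have k20 : k 2 0 = 0 by rewrite kcol.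
clearbody k; have := SO3_inner 0 0 Sk; rewrite /inner sum3E !mxE k00 eqxx mulr1 => k0.
have /eqP : k 0 1 ^+ 2 + k 0 2 ^+ 2 = 0 by move: k0 => /=; rewrite !expr2; lra.
rewrite paddr_eq0 ?sqr_ge0 // !sqrf_eq0 => /andP[/eqP k01 /eqP k02].
have kc i j : k i j = cof k i j by rewrite (SO3_cof Sk).
have k11 : k 1 1 = k 2 2 by rewrite kc !mxE !ord3E k00 k02; ring.
have k12 : k 1 2 = - k 2 1 by rewrite kc !mxE !ord3E k00 k01; ring.
have n2 : k 1 1 ^+ 2 + k 2 1 ^+ 2 = 1.
  by have := kc 0 0; rewrite k00 !mxE !ord3E -k11 k12 => ->; ring.
have [gamma [gammapi cg sg]] := angle_exists n2.
exists alpha, beta, gamma; split=> //; rewrite mulmxA -/h gE; congr (_ *m _).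
rewrite rotmx0E cg sg; apply/matrixP; do 2 apply: all3P; rewrite !mxE /=
  ?k00 ?k10 ?k20 ?k01 ?k02 ?k12 ?k11 //.
Qed.

(** By the Euler angles three turns about the first two rows connect the two points,
    and the speed of these turns is O(s^(1/4)) because |a_1| / |a_2| is bounded
    when r > 0. *)
Lemma rotation_bound q r (s : R) g g' f : 0 <= q -> 0 < r -> 0 < s -> SO3 g ->
  SO3 g' ->
  short (leaf q r) f ->
  `|f (polar q r s g') - f (polar q r s g)| <=
    3 * (Num.sqrt ((r + q) / r) * Num.sqrt (Num.sqrt s) * pi).
Proof.
move=> q0 r0 s0 Sg Sg' sf; have r0' := ltW r0.
pose C := (r + q) / r; have C1 : 1 <= C by rewrite ler_pdivlMr // mul1r lerDl.
have C0 : 0 < C by exact: lt_le_trans C1.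
have Cr : C * r = r + q by rewrite /C divfK // gt_eqF.
set sigma := Num.sqrt ((r + q) / r) * Num.sqrt (Num.sqrt s).
have sigma0 : 0 <= sigma by rewrite mulr_ge0 // sqrtr_ge0.
have su0 : 0 < Num.sqrt s by rewrite sqrtr_gt0.
have x0 : 0 < Num.sqrt (s + r + q) by rewrite sqrtr_gt0; lra.
have y0 : 0 < Num.sqrt (s + r) by rewrite sqrtr_gt0; lra.
have sE : sigma ^+ 2 = C * Num.sqrt s by rewrite exprMn !sqr_sqrtr // ?ltW.
have zE : Num.sqrt s ^+ 2 = s by rewrite sqr_sqrtr // ltW.
have yE : Num.sqrt (s + r) ^+ 2 = s + r by rewrite sqr_sqrtr //; lra.
have xE : Num.sqrt (s + r + q) ^+ 2 = s + r + q by rewrite sqr_sqrtr //; lra.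
have yx : Num.sqrt (s + r) <= Num.sqrt (s + r + q) by rewrite ler_wsqrtr //; lra.
have xy : Num.sqrt (s + r + q) <= C * Num.sqrt (s + r).
  have Cy0 : 0 <= C * Num.sqrt (s + r) by rewrite mulr_ge0 // ltW.
  rewrite -(@ler_pXn2r _ 2) ?nnegrE ?sqrtr_ge0 // exprMn xE yE.
  have : s + r + q <= C * (s + r) by rewrite mulrDr Cr; nra.
  by move=> H; apply: le_trans H _;
    rewrite expr2 -mulrA ler_peMl // mulr_ge0 ?ltW //; lra.
have yCx : Num.sqrt (s + r) <= C * Num.sqrt (s + r + q).
  by apply: le_trans yx _; rewrite ler_peMl // ltW.
have step j h theta : j != 2 -> SO3 h -> `|theta| <= pi ->
    `|f (polar q r s (rotmx j theta *m h)) - f (polar q r s h)| <= sigma * pi.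
  move=> j2 Sh tpi; apply: le_trans (_ : sigma * `|theta - 0| <= _); last first.
    by rewrite subr0 ler_wpM2l.
  have -> : polar q r s h = turn q r s h j 0 by rewrite /turn rotmx0 mul1mx.
  apply: (@turn_bound q r s h f j) => //; rewrite sE /vol.
  have -> : sqlen q r s (j + 1) * sqlen q r s (j + 2) = if j == 0
      then Num.sqrt (s + r) * Num.sqrt (s + r) * Num.sqrt s ^+ 2
      else Num.sqrt (s + r + q) * Num.sqrt (s + r + q) * Num.sqrt s ^+ 2.
    by rewrite -!expr2 yE xE zE; move: j j2; apply: all3P;
      rewrite !ord3E /sqlen //= => _; ring.
  move: (Num.sqrt (s + r + q)) (Num.sqrt (s + r)) (Num.sqrt s) x0 y0 su0 xy yCx
    => x y z x0 y0 z0 xy yCx.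
  have xz : 0 <= x * z ^+ 2 by rewrite mulr_ge0 ?exprn_ge0 // ltW.
  have yz : 0 <= y * z ^+ 2 by rewrite mulr_ge0 ?exprn_ge0 // ltW.
  case: ifP => _.
    by have := ler_wpM2l yz yCx; lra.
  by have := ler_wpM2l xz xy; lra.
have [alpha [beta [gamma [api bpi cpi LE]]]] :=
  euler_angles (SO3_mul Sg' (SO3_tr Sg)).
have g'E : g' = rotmx 0 alpha *m (rotmx 1 beta *m (rotmx 0 gamma *m g)).
  by rewrite !mulmxA -[_ *m rotmx 1 beta *m _]mulmxA -LE -mulmxA (mulmx1C Sg.1)
    mulmx1.
have S1 : SO3 (rotmx 0 gamma *m g) by exact: SO3_mul (rotmx_SO3 _ _) Sg.
have S2 : SO3 (rotmx 1 beta *m (rotmx 0 gamma *m g)) by exact: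
  SO3_mul (rotmx_SO3 _ _) S1.
have := step 0 _ _ isT Sg cpi; have := step 1 _ _ isT S1 bpi; have :=
  step 0 _ _ isT S2 api.
rewrite -g'E !ler_norml => /andP[? ?] /andP[? ?] /andP[? ?].
by apply/andP; split; lra.
Qed.

Lemma radius_le q r (u v : R) : u <= v -> radius q r u <= radius q r v.
Proof.
move=> uv; rewrite /radius ler_wpM2r ?invr_ge0 ?sqrtr_ge0 // ler_wpM2l //.
by apply: ler_pM; rewrite ?sqrtr_ge0 // ?ler_wsqrtr.
Qed.

(** Near the boundary points lie arbitrarily close to each other: move radially to
    the same level, then turn. Hence two points at distance at most rho from the
    boundary are at distance at most 2 rho. *)
Lemma not_wide_type2 q r : 0 <= q -> 0 < r -> ~ wide (leaf q r) 3.
Proof.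
move=> q0 r0 [x [y [rho [_ rho0 ncx ncy [f sf fxy]]]]]; have r0' := ltW r0.
pose k := Num.sqrt (Num.sqrt (r * (r + q))).
have k0 : 0 < k by rewrite !sqrtr_gt0 mulr_gt0 // ltr_wpDr.
pose A := 3 * (Num.sqrt ((r + q) / r) * pi) + 2 / 3 / k.
have A0 : 0 < A.
  by apply: ltr_wpDl; [rewrite !mulr_ge0 ?sqrtr_ge0 ?pi_ge0|rewrite divr_gt0].
(* At level E ^+ 4 both costs, of turning and of moving radially, are at most linear
   in E as long as E <= 1. *)
pose E := Num.min 1 (rho / 2 / A).
have E0 : 0 < E by rewrite lt_min ltr01 /= !divr_gt0.
have E1 : E <= 1 by rewrite ge_min lexx.
have EA : A * E <= rho / 2 by rewrite mulrC -ler_pdivlMr // ge_min lexx orbT.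
have eps0 : 0 < E ^+ 4 by rewrite exprn_gt0.
have s2 : Num.sqrt (E ^+ 4) = E ^+ 2.
  by rewrite (exprM E 2 2) sqrtr_sqr ger0_norm // exprn_ge0 // ltW.
have s4 : Num.sqrt (Num.sqrt (E ^+ 4)) = E by rewrite s2 sqrtr_sqr gtr0_norm.
have rE : radius q r (E ^+ 4) <= 2 / 3 / k * E.
  rewrite /radius s2 sqrtr_sqr gtr0_norm // -/k.
  rewrite (_ : _ / k = 2 / 3 / k * (E ^+ 3)); last by ring.
  apply: ler_wpM2l; first by rewrite divr_ge0 // ltW.
  by rewrite exprS ler_piMr ?(ltW E0) // exprn_ile1 // ltW.
have [z [Nz zx] zs] := escape_deep q0 r0' eps0 ncx.
have [z' [Nz' zy] zs'] := escape_deep q0 r0' eps0 ncy.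
have [s [g [s0 Sg zE]]] := leaf_polar Nz q0 r0'.
have [s' [g' [s0' Sg' zE']]] := leaf_polar Nz' q0 r0'.
move: zs zs'; rewrite zE zE' !sqnorm_polar // /sqlen /= => /ltW zs /ltW zs'.
have rad (u v : R) : 0 < u -> u <= v -> v <= E ^+ 4 ->
    `|f (polar q r v g') - f (polar q r u g')| <= radius q r (E ^+ 4).
  move=> u0 uv vE.
  apply: le_trans (radial_bound q0 r0' Sg' sf u0 uv (fun w => radius_speed q0 r0)) _.
  by have := radius_ge0 q r u; have := radius_le q r vE; lra.
have {}rad : `|f z' - f (polar q r s g')| <= radius q r (E ^+ 4).
  rewrite zE'; have [ss'|/ltW s's] := leP s s'; first exact: rad.
  by rewrite distrC; exact: rad.
have rotmx := rotation_bound q0 r0 s0 Sg Sg' sf.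
have rot' : `|f (polar q r s g') - f z| <= 3 * (Num.sqrt ((r + q) / r) * pi) * E.
  rewrite zE; apply: le_trans rotmx _.
  have uE : Num.sqrt (Num.sqrt s) <= E by rewrite -[X in _ <= X]s4 !ler_wsqrtr.
  rewrite [X in X <= _](_ : _ =
    3 * (Num.sqrt ((r + q) / r) * pi) * Num.sqrt (Num.sqrt s)).
    by rewrite ler_wpM2l // !mulr_ge0 ?sqrtr_ge0 ?pi_ge0.
  by ring.
have := zx _ sf; have := zy _ sf; move: rad rot' EA rE fxy; rewrite /A mulrDl.
rewrite !ler_norml => /andP[? ?] /andP[? ?] ? ? ? /andP[? ?] /andP[? ?].
lra.
Qed.

(** * The leaf of type 0 is flat *)

(** The map from quaternions to multiples of rotations, x |-> q x conj q. *)
Definition qrot (w x y z : R) : 'M[R]_3 :=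
  mx3 (w * w + x * x - y * y - z * z) (2 * (x * y - w * z)) (2 * (x * z + w * y))
      (2 * (x * y + w * z)) (w * w - x * x + y * y - z * z) (2 * (y * z - w * x))
      (2 * (x * z - w * y)) (2 * (y * z + w * x)) (w * w - x * x - y * y + z * z).

(** The derivative of qrot at (w,x,y,z) in the direction (w',x',y',z'). *)
Definition dqrot (w x y z w' x' y' z' : R) : 'M[R]_3 :=
  2 *: mx3 (w * w' + x * x' - y * y' - z * z') (x * y' + x' * y - w * z' - w' * z)
                  (x * z' + x' * z + w * y' + w' * y)
      (x * y' + x' * y + w * z' + w' * z) (w * w' - x * x' + y * y' - z * z')
                  (y * z' + y' * z - w * x' - w' * x)
      (x * z' + x' * z - w * y' - w' * y) (y * z' + y' * z + w * x' + w' * x)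
                  (w * w' - x * x' - y * y' + z * z').

Lemma qrotM (w x y z w' x' y' z' : R) :
  qrot w x y z *m qrot w' x' y' z' =
  qrot (w * w' - x * x' - y * y' - z * z') (w * x' + x * w' + y * z' - z * y')
       (w * y' + y * w' + z * x' - x * z') (w * z' + z * w' + x * y' - y * x').
Proof. by apply/matrixP; do 2 apply: all3P; rewrite !mxE sum3E !mxE /=; ring. Qed.

Lemma qrot_gram (w x y z : R) : qrot w x y z *m (qrot w x y z)^T =
  ((w ^+ 2 + x ^+ 2 + y ^+ 2 + z ^+ 2) ^+ 2)%:M.
Proof.
by apply/matrixP; do 2 apply: all3P; rewrite !mxE sum3E !mxE /= ?mulr1n ?mulr0n; ring.
Qed.

Lemma Phi_qrot (w x y z : R) :
  Phi (qrot w x y z) = (w ^+ 2 + x ^+ 2 + y ^+ 2 + z ^+ 2) ^+ 3.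
Proof. by rewrite PhiE !mxE /=; ring. Qed.

Lemma qrotZ (k w x y z : R) :
  qrot (k * w) (k * x) (k * y) (k * z) = k ^+ 2 *: qrot w x y z.
Proof. by apply/matrixP; do 2 apply: all3P; rewrite !mxE /=; ring. Qed.

Lemma qrot_line (u w x y z w' x' y' z' : R) :
  qrot (w + u * w') (x + u * x') (y + u * y') (z + u * z') =
  qrot w x y z + u *: dqrot w x y z w' x' y' z' + u ^+ 2 *: qrot w' x' y' z'.
Proof. by apply/matrixP; do 2 apply: all3P; rewrite !mxE /=; ring. Qed.

Lemma dqrot_line (u w x y z w' x' y' z' : R) :
  dqrot (w + u * w') (x + u * x') (y + u * y') (z + u * z') w' x' y' z' =
  dqrot w x y z w' x' y' z' + (2 * u) *: qrot w' x' y' z'.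
Proof. by apply/matrixP; do 2 apply: all3P; rewrite !mxE /=; ring. Qed.

(** The derivative of qrot at q in the direction v, times the transpose of qrot q, is
    |q|^2 (kappa + [k]) with kappa + k = 2 v conj q, of norm 2 |v| |q|. *)
Lemma dqrot_speed (w x y z w' x' y' z' : R)
  (P := dqrot w x y z w' x' y' z' *m (qrot w x y z)^T) :
  P 0 0 ^+ 2 + P 2 1 ^+ 2 + P 0 2 ^+ 2 + P 1 0 ^+ 2 =
  4 * (w ^+ 2 + x ^+ 2 + y ^+ 2 + z ^+ 2) ^+ 3 *
      (w' ^+ 2 + x' ^+ 2 + y' ^+ 2 + z' ^+ 2).
Proof.
pose n := w ^+ 2 + x ^+ 2 + y ^+ 2 + z ^+ 2.
have -> : P 0 0 = 2 * n * (w * w' + x * x' + y * y' + z * z').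
  by rewrite /n !mxE sum3E !mxE /=; ring.
have -> : P 2 1 = 2 * n * (w * x' - x * w' + y * z' - z * y').
  by rewrite /n !mxE sum3E !mxE /=; ring.
have -> : P 0 2 = 2 * n * (w * y' - y * w' + z * x' - x * z').
  by rewrite /n !mxE sum3E !mxE /=; ring.
have -> : P 1 0 = 2 * n * (w * z' - z * w' + x * y' - y * x').
  by rewrite /n !mxE sum3E !mxE /=; ring.
by rewrite /n; ring.
Qed.

Lemma rotmx0_qrot (u : R) : rotmx 0 u = qrot (cos (u / 2)) (sin (u / 2)) 0 0.
Proof.
rewrite rotmx0E {1 2 3 4}(splitr u) cosD sinD.
have := cos2Dsin2 (u / 2) => cs.
apply/matrixP; do 2 apply: all3P; rewrite !mxE /=; try ring.
by rewrite -[LHS]cs; ring.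
Qed.

Lemma rotmx1_qrot (u : R) : rotmx 1 u = qrot (cos (u / 2)) 0 (sin (u / 2)) 0.
Proof.
rewrite rotmx1E {1 2 3 4}(splitr u) cosD sinD.
have := cos2Dsin2 (u / 2) => cs.
apply/matrixP; do 2 apply: all3P; rewrite !mxE /=; try ring.
by rewrite -[LHS]cs; ring.
Qed.

(** Turns about the axes come from quaternions by half-angles, hence so do all
    rotations by euler_angles; and q and -q give the same rotation. *)
Lemma SO3_qrot g : SO3 g -> exists w x y z : R,
  [/\ g = qrot w x y z, w ^+ 2 + x ^+ 2 + y ^+ 2 + z ^+ 2 = 1 & 0 <= w].
Proof.
move=> Sg.
have norm1 w x y z : g = qrot w x y z -> w ^+ 2 + x ^+ 2 + y ^+ 2 + z ^+ 2 = 1.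
  move=> gE; have := Sg.1; rewrite gE qrot_gram => /matrixP/(_ 0 0).
  rewrite !mxE /= mulr1n => /eqP; rewrite sqrf_eq1 => /orP[/eqP //|/eqP n1].
  by have := sqr_ge0 w; have := sqr_ge0 x; have := sqr_ge0 y; have := sqr_ge0 z; lra.
have [alpha [beta [gamma [_ _ _]]]] := euler_angles Sg.
rewrite !rotmx0_qrot rotmx1_qrot !qrotM; set w := (X in qrot X _ _ _).
set x := (X in qrot _ X _ _); set y := (X in qrot _ _ X _); set z :=
  (X in qrot _ _ _ X) => gE.
have [w0|/ltW w0] := leP 0 w; first by exists w, x, y, z; split=> //; exact: norm1.
have gE' : g = qrot (- w) (- x) (- y) (- z).
  by rewrite gE; apply/matrixP; do 2 apply: all3P; rewrite !mxE /=; ring.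
by exists (- w), (- x), (- y), (- z); split=> //; [exact: norm1|rewrite oppr_ge0].
Qed.

Lemma der_quadratic (A B C : 'M[R]_3) (u : R) :
  is_derive u (1 : R) (fun v => A + v *: B + v ^+ 2 *: C) (B + (2 * u) *: C).
Proof.
apply/der_mxP => i j; rewrite (_ : (fun _ => _) = fun v =>
  A i j + v * B i j + v * v * C i j); last first.
  by apply/funext => v; rewrite !mxE expr2.
have du := is_derive_id u (1 : R).
apply: (der_eq (derD (derD (der_cst _ u) (derM du (der_cst _ u))) (derM (derM du
  du) (der_cst _ u)))).
by rewrite !mxE; ring.
Qed.

Lemma polar_gram0 (s : R) g : 0 < s -> SO3 g ->
  polar 0 0 s g *m (polar 0 0 s g)^T = s%:M.
Proof.
move=> s0 Sg; apply/matrixP => i j; rewrite polar_gram Sg.1.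
have le k : sqlen 0 0 s k = s by move: k; apply: all3P; rewrite /sqlen /= ?addr0.
rewrite !le -expr2 sqr_sqrtr; last exact: ltW.
by rewrite !mxE; case: eqP => _; rewrite ?mulr1n ?mulr0n ?mulr1 ?mulr0.
Qed.

Lemma qrot_leaf (w x y z s : R) g : 0 < s -> SO3 g ->
  0 < w ^+ 2 + x ^+ 2 + y ^+ 2 + z ^+ 2 -> leaf 0 0 (qrot w x y z *m polar 0 0 s g).
Proof.
move=> s0 Sg n0; have xx := polar_gram0 s0 Sg.
have G i j : inner (row i (qrot w x y z *m polar 0 0 s g)) (row j (qrot w x y z
  *m polar 0 0 s g)) =
    s * (w ^+ 2 + x ^+ 2 + y ^+ 2 + z ^+ 2) ^+ 2 * (i == j)%:R.
  rewrite -gram_entry trmx_mul mulmxA -[_ *m polar _ _ _ _ *m _]mulmxA xx.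
  by rewrite mul_mx_scalar -scalemxAl qrot_gram !mxE mulr_natr mulrnAr.
split.
- by move=> i j /negPf ij; rewrite G ij mulr0.
- by rewrite !G subrr.
- by rewrite !G subrr.
rewrite PhiM Phi_qrot Phi_polar ((SO3P g).1 Sg).2 mulr1 mulrN oppr_lt0.
by rewrite mulr_gt0 ?exprn_gt0 // vol_gt0.
Qed.

(** Under q |-> q x conj q the metric becomes a constant multiple of the Euclidean
    one, and a segment in the half space of nonnegative real part from 1 to a
    nonzero point avoids 0. Here (w - 1)^2 <= 1 + w^2 because w >= 0. *)
Lemma line_bound (s w x y z : R) g f : 0 < s -> SO3 g -> short (leaf 0 0) f ->
  0 <= w -> 0 < w ^+ 2 + x ^+ 2 + y ^+ 2 + z ^+ 2 ->
  (f (qrot w x y z *m polar 0 0 s g) - f (polar 0 0 s g)) ^+ 2 <=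
  4 * Num.sqrt s * (1 + (w ^+ 2 + x ^+ 2 + y ^+ 2 + z ^+ 2)).
Proof.
move=> s0 Sg sf w0 n0.
pose a := polar 0 0 s g; pose v := w - 1.
have w1 : 1 + v = w by rewrite /v; ring.
pose m := v ^+ 2 + x ^+ 2 + y ^+ 2 + z ^+ 2.
pose c (u : R) := qrot (1 + u * v) (0 + u * x) (0 + u * y) (0 + u * z) *m a.
pose n (u : R) := (1 + u * v) ^+ 2 + (0 + u * x) ^+ 2 + (0 + u * y) ^+ 2 + (0 +
  u * z) ^+ 2.
have m0 : 0 <= m by rewrite !addr_ge0 // sqr_ge0.
have mle : m <= 1 + (w ^+ 2 + x ^+ 2 + y ^+ 2 + z ^+ 2) by rewrite /m /v; lra.
have su0 : 0 < Num.sqrt s by rewrite sqrtr_gt0.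
have npos u : 0 <= u <= 1 -> 0 < n u.
  move=> /andP[u0 u1]; have [->|u1'] := eqVneq u 1.
    by rewrite /n !mul1r !add0r w1.
  have q0 : 0 < 1 + u * v.
    have : u < 1 by rewrite lt_neqAle u1' u1.
    by rewrite /v; nra.
  by rewrite /n -!addrA ltr_pwDl ?exprn_gt0 // !addr_ge0 ?sqr_ge0.
pose sigma := Num.sqrt (4 * Num.sqrt s * m).
have sE : sigma ^+ 2 = 4 * Num.sqrt s * m by rewrite sqr_sqrtr // !mulr_ge0 // ltW.
have c1 : c 1 = qrot w x y z *m a by rewrite /c !mul1r !add0r w1.
have c0 : c 0 = a.
  rewrite /c !mul0r !addr0 (_ : qrot 1 0 0 0 = 1%:M) ?mul1mx //.
  by apply/matrixP; do 2 apply: all3P; rewrite !mxE /=; ring.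
have : `|f (c 1) - f (c 0)| <= sigma * 1 - sigma * 0.
  apply: (@speed_bound _ f c (fun u => sigma * u) (fun=> sigma) 0 1 sf ler01) =>
    u u01.
  split.
    by apply: (der_eq (derM (der_cst sigma u) (is_derive_id _ _)));
      rewrite mul0r add0r mulr1.
  split; first exact: sqrtr_ge0.
  have cn : {for u, continuous n}.
    have du k l : is_derive u (1 : R) (fun w => k + w * l) l.
      by apply: (der_eq (derD (der_cst k u) (derM (is_derive_id u 1) (der_cst l
        u)))); rewrite add0r mul1r mulr0 addr0.
    have dn := derD (derD (derD (derM (du 1 v) (du 1 v)) (derM (du 0 x) (du 0 x)))
       (derM (du 0 y) (du 0 y))) (derM (du 0 z) (du 0 z)).
    apply: differentiable_continuous; apply/derivable1_diffP.
    rewrite (_ : n = fun u => (1 + u * v) * (1 + u * v) + (0 + u * x) * (0 + u * x)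
        + (0 + u * y) * (0 + u * y) + (0 + u * z) * (0 + u * z)); last first.
      by apply/funext => t; rewrite /n !expr2.
    exact: dn.(ex_derive).
  pose X := dqrot (1 + u * v) (0 + u * x) (0 + u * y) (0 + u * z) v x y z *m a.
  have vX : velocity (leaf 0 0) c u X.
    split.
      have nn : \forall t \near u, 0 < n t.
        by apply: (cvgr_gt (n u) cn); exact: npos.
      by near=> t; apply: qrot_leaf => //; near: t.
    rewrite /X dqrot_line.
    have := der_mulmx2 1%:M a (der_quadratic (qrot 1 0 0 0) (dqrot 1 0 0 0 v x y
      z) (qrot v x y z) u).
    rewrite mul1mx; congr is_derive; apply/funext => t.
    by rewrite mul1mx /c qrot_line.
  exists X => //; rewrite (velocity_metric vX).
  have XE i j : (X *m (c u)^T) i j = s * (dqrot (1 + u * v) (0 + u * x) (0 + u * y)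
      (0 + u * z) v x y z *m (qrot (1 + u * v) (0 + u * x) (0 + u * y) (0 + u *
        z))^T) i j.
    rewrite /X /c trmx_mul mulmxA -[_ *m a *m a^T]mulmxA polar_gram0 //.
    by rewrite mul_mx_scalar -scalemxAl [LHS]mxE.
  rewrite !XE !exprMn -!mulrDr dqrot_speed -/(n u) -/m sE.
  rewrite /c PhiM Phi_qrot -/(n u) Phi_polar ((SO3P g).1 Sg).2 !addr0.
  have nu := npos u u01; have tE := sqr_sqrtr (ltW s0).
  move: su0 tE; set t := Num.sqrt s => su0 tE; rewrite -tE.
  rewrite le_eqVlt; apply/orP; left; apply/eqP; field.
  by rewrite !gt_eqF.
rewrite c1 c0 mulr1 mulr0 subr0 => H.
rewrite -real_normK ?num_real //.
apply: le_trans (_ : sigma ^+ 2 <= _).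
  by rewrite ler_pXn2r // nnegrE; exact: sqrtr_ge0.
by rewrite sE ler_wpM2l // mulr_ge0 // ltW.
Unshelve. all: by end_near. Qed.

(** By short_norm the number 2 |a_1|^(1/2) is at most rho at both points; by
    line_bound the squared distance is at most the sum of the squares of these
    two numbers. *)
Lemma not_wide_type0 : ~ wide (leaf 0 0) (3 / 2 : R).
Proof.
move=> [x [y [rho [[Nx Ny] rho0 ncx ncy [f sf fxy]]]]].
have sn a : leaf 0 0 a -> sqnorm a 2 = sqnorm a 0 by case=> _; rewrite /sqnorm; lra.
have far a : leaf 0 0 a ->
  ~ relatively_compact (leaf 0 0) (short_ball (leaf 0 0) a rho) ->
    2 * Num.sqrt (Num.sqrt (sqnorm a 0)) <= rho.
  move=> Na nca; apply/ler_addgt0Pr => e e0.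
  have [z [Nz za] zs] := escape_deep (lexx 0) (lexx 0) (exprn_gt0 4 (divr_gt0 e0
    (ltr0Sn _ 1))) nca.
  have := za _ (short_norm (lexx 0) (lexx 0)); rewrite -(sn z Nz).
  have : Num.sqrt (Num.sqrt (sqnorm z 2)) <= e / 2.
    have -> : e / 2 = Num.sqrt (Num.sqrt ((e / 2) ^+ 4)).
      have e2 : 0 <= e / 2 by rewrite divr_ge0 // ltW.
      by rewrite (exprM (e / 2) 2 2) sqrtr_sqr ger0_norm ?exprn_ge0 // sqrtr_sqr
        ger0_norm.
    by rewrite !ler_wsqrtr // ltW.
  by rewrite ler_norml => ? /andP[? ?]; lra.
have fx := far x Nx ncx; have fy := far y Ny ncy.
have [s [g [s0 Sg xE]]] := leaf_polar Nx (lexx 0) (lexx 0).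
have [s' [g' [s0' Sg' yE]]] := leaf_polar Ny (lexx 0) (lexx 0).
move: fx fy; rewrite xE yE !sqnorm_polar // /sqlen /= !addr0 => fx fy.
have [a [b [c [d [gE n1 a0]]]]] := SO3_qrot (SO3_mul Sg' (SO3_tr Sg)).
have u0 : 0 < Num.sqrt s by rewrite sqrtr_gt0.
have u0' : 0 < Num.sqrt s' by rewrite sqrtr_gt0.
(* qrot is quadratic: k scales the rows from length sqrt s to sqrt s'. *)
pose k := Num.sqrt (Num.sqrt s' / Num.sqrt s).
have kE : k ^+ 2 = Num.sqrt s' / Num.sqrt s by rewrite sqr_sqrtr // divr_ge0 // ltW.
have kn : (k * a) ^+ 2 + (k * b) ^+ 2 + (k * c) ^+ 2 + (k * d) ^+ 2 =
  Num.sqrt s' / Num.sqrt s.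
  by rewrite -kE -[RHS]mulr1 -n1; ring.
have yx : qrot (k * a) (k * b) (k * c) (k * d) *m polar 0 0 s g = polar 0 0 s' g'.
  have pE (t : R) h : polar 0 0 t h = - Num.sqrt t *: h.
    apply/matrixP => i j; rewrite !mxE; congr (- Num.sqrt _ * _).
    by move: i; apply: all3P; rewrite /sqlen /= ?addr0.
  rewrite qrotZ -gE !pE kE -scalemxAl -scalemxAr scalerA -mulmxA (mulmx1C Sg.1)
    mulmx1.
  by congr (_ *: _); field; rewrite gt_eqF.
have ka0 : 0 <= k * a by rewrite mulr_ge0 ?sqrtr_ge0.
have := @line_bound s (k * a) (k * b) (k * c) (k * d) g f s0 Sg sf ka0;
  rewrite kn yx -yE -xE => /(_ (divr_gt0 u0' u0)).
rewrite mulrDr mulr1 -[4 * Num.sqrt s * _]mulrA [Num.sqrt s * _]mulrC divfK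
  ?gt_eqF //.
have -> : Num.sqrt s = Num.sqrt (Num.sqrt s) ^+ 2 by rewrite sqr_sqrtr // ltW.
have -> : Num.sqrt s' = Num.sqrt (Num.sqrt s') ^+ 2 by rewrite sqr_sqrtr // ltW.
have := sqrtr_ge0 (Num.sqrt s); have := sqrtr_ge0 (Num.sqrt s').
move: fx fy fxy.
move: (Num.sqrt (Num.sqrt s)) (Num.sqrt (Num.sqrt s')) (f x) (f y) =>
  p p' F F' p1 p1' H p0' p0 H2.
have : (3 / 2 * rho) ^+ 2 <= (F' - F) ^+ 2.
  by rewrite -[X in _ <= X]sqrrN opprB ler_pXn2r // nnegrE; lra.
have : p ^+ 2 <= (rho / 2) ^+ 2 by rewrite ler_pXn2r ?nnegrE //; lra.
have : p' ^+ 2 <= (rho / 2) ^+ 2 by rewrite ler_pXn2r ?nnegrE //; lra.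
have : 0 < rho ^+ 2 by rewrite exprn_gt0.
rewrite !exprMn; lra.
Qed.

(** * Distinguishing the types *)

Lemma wide_le (N : set 'M[R]_3) (M M' : R) : M <= M' -> wide N M' -> wide N M.
Proof.
move=> MM' [x [y [rho [Nxy rho0 ncx ncy [f sf fxy]]]]].
exists x, y, rho; split=> //; exists f => //; apply: le_trans fxy.
by rewrite ler_wpM2r // ltW.
Qed.

(** Type 0 is not even 3/2-wide, type 1 is 3-wide, and type 2 lies in between. *)
Lemma leaf_type_wide q r : 0 <= q -> 0 <= r ->
  (wide (leaf q r) (3 / 2) <-> leaf_type q r <> 0%N) /\
  (wide (leaf q r) 3 <-> leaf_type q r = 1%N).
Proof.
move=> q0 r0; rewrite /leaf_type; case: ltP => [r1|/(conj r0)/andP/le_anti <-].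
  split; first by split=> // _; exact: wide_type2.
  by split=> // /(not_wide_type2 q0 r1).
case: ltP => [q1|/(conj q0)/andP/le_anti <-].
  by split; split=> // _; apply: wide_type1.
split; first by split=> // /not_wide_type0.
by split=> // /(@wide_le _ (3 / 2)) w; case: not_wide_type0; apply: w; lra.
Qed.

Lemma leaf_type_isomorphic q r q' r' : 0 <= q -> 0 <= r -> 0 <= q' -> 0 <= r' ->
  hyperkahler_isomorphic (leaf q r) (leaf q' r') -> leaf_type q r = leaf_type q' r'.
Proof.
move=> q0 r0 q0' r0' iso.
have [w0 w1] := leaf_type_wide q0 r0; have [w0' w1'] := leaf_type_wide q0' r0'.
have i0 := wide_isomorphic (3 / 2) q0 r0 iso; have i1 := wide_isomorphic 3 q0 r0 iso.
have e0 : leaf_type q r <> 0%N <-> leaf_type q' r' <> 0%N by tauto.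
have e1 : leaf_type q r = 1%N <-> leaf_type q' r' = 1%N by tauto.
have type012 (u v : R) : [\/ leaf_type u v = 0%N, leaf_type u v =
  1%N | leaf_type u v = 2%N :> nat].
  by rewrite /leaf_type; case: ifP => _; [apply: Or33|case: ifP => _; [apply:
    Or32|apply: Or31]].
by case: (type012 q r) e0 e1 => ->; case: (type012 q' r') => -> //;
  intuition congruence.
Qed.

(** * Dilations *)

Lemma Ck_cst (V W : normedModType R) n (U : set V) (k : W) : Ck n U (fun=> k).
Proof.
elim: n k => [|n IH] k /=; first by move=> x _; exact: cvg_cst.
split=> [x _|v]; first exact: differentiable_cst.
rewrite (_ : (fun _ => _) = fun=> 0) //; apply/funext => x.
by rewrite (diff_cst k x).
Qed.

Lemma smooth_scale (V : normedModType R) (U : set V) (k : R) :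
  smooth U ( *:%R k : V -> V).
Proof.
have dk x : differentiable ( *:%R k : V -> V) x.
  by have [] := is_diff_scaler k x.
case=> [|n] /=; first by move=> x _; exact: differentiable_continuous.
split=> [x _|v]; first exact: dk.
rewrite (_ : (fun _ => _) = fun=> k *: v); first exact: Ck_cst.
by apply/funext => x; have [_ ->] := is_diff_scaler k x.
Qed.

Lemma cof_rho (t : R) a : cof (rho t a) = Num.sqrt t ^+ 2 *: cof a.
Proof. by apply/matrixP => j k; rewrite !mxE; ring. Qed.

(** The frame is quadratic in a. *)
Lemma frame_rho (t : R) a c : 0 < t ->
  frame (rho t a) c = Num.sqrt t ^+ 2 *: frame a c.
Proof. by move=> t0; rewrite /frame cof_rho scalemxAr. Qed.

Lemma Phi_rho (t : R) a : Phi (rho t a) = Num.sqrt t ^+ 3 * Phi a.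
Proof. by rewrite !PhiE !mxE; ring. Qed.

Lemma rho_leaf q r (t : R) a : 0 < t -> leaf q r a -> leaf (q * t) (r * t) (rho t a).
Proof.
move=> t0 [ort eq er Pa].
have G i j : inner (row i (rho t a)) (row j (rho t a)) =
  t * inner (row i a) (row j a).
  rewrite -!gram_entry -[in RHS](sqr_sqrtr (ltW t0)) !mxE mulr_sumr.
  by apply: eq_bigr => k _; rewrite !mxE; ring.
split.
- by move=> i j ij; rewrite G ort // mulr0.
- by rewrite !G -mulrBr eq mulrC.
- by rewrite !G -mulrBr er mulrC.
by rewrite Phi_rho pmulr_rlt0 // exprn_gt0 // sqrtr_gt0.
Qed.

Lemma rhoK (t u : R) a : 0 < t -> t * u = 1 -> rho u (rho t a) = a.
Proof.
move=> t0 tu; rewrite /rho scalerA mulrC -sqrtrM ?tu ?sqrtr1 ?scale1r //.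
exact: ltW.
Qed.

Lemma smooth_on_rho (N : set 'M[R]_3) (t : R) : smooth_on N (rho t).
Proof.
move=> a _; exists (rho t), setT; split=> //; first exact: openT.
exact: smooth_scale.
Qed.

Lemma rho_diffeomorphism q r (t : R) : 0 < t ->
  diffeomorphism (leaf q r) (leaf (q * t) (r * t)) (rho t).
Proof.
move=> t0; have tV0 : 0 < t^-1 by rewrite invr_gt0.
have tV : t * t^-1 = 1 by rewrite mulfV // gt_eqF.
exists (rho t^-1); split.
- exact: smooth_on_rho.
- exact: smooth_on_rho.
- by move=> a La; split; [exact: rho_leaf|exact: rhoK].
move=> b Lb; split; last by apply: rhoK => //; rewrite mulrC.
by have := rho_leaf tV0 Lb; rewrite -!mulrA tV !mulr1.
Qed.

(** rho_t is linear, but the tangent map is computed from an arbitrary extension;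
    the two agree on velocities of curves in the leaf. *)
Lemma tangent_map_rho q r (t : R) a c : 0 <= q -> 0 <= r -> 0 < t -> leaf q r a ->
  tangent_map (leaf q r) (rho t) a (frame a c) =
    frame (rho t a) ((Num.sqrt t)^-1 *: c).
Proof.
move=> q0 r0 t0 La; have sF : smooth_on (leaf q r) (rho t) by exact: smooth_on_rho.
have st0 : Num.sqrt t != 0 by rewrite gt_eqF // sqrtr_gt0.
have -> : frame (rho t a) ((Num.sqrt t)^-1 *: c) = Num.sqrt t *: frame a c.
  rewrite frame_rho // -[_ *: c]addr0 frame_linear frame0 addr0 scalerA.
  by congr (_ *: _); field.
have H k : tangent_map (leaf q r) (rho t) a (frame a (delta_mx 0 k)) =
    Num.sqrt t *: frame a (delta_mx 0 k).
  have [p [u [X [kappa [pu vX ->]]]]] := frame_velocity k La q0 r0.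
  have t00 : tangent_map (leaf q r) (rho t) a 0 = 0.
    by have [G _ ->] := tangent_map_ext sF La; exact: linear0.
  rewrite -[kappa *: X]addr0 tangent_map_linear // t00 !addr0 scalerA mulrC -scalerA.
  congr (_ *: _); apply: der_uniq (_ : is_derive u (1 : R) (rho t \o p) _).
    by have := tangent_map_curve sF vX; rewrite pu.
  exact: is_deriveZ vX.2.
have t00 : tangent_map (leaf q r) (rho t) a 0 = 0.
  by have [G _ ->] := tangent_map_ext sF La; exact: linear0.
rewrite (matrix_sum_delta c) big_ord1.
elim/big_rec: _ => [|k x _ IH]; first by rewrite frame0 t00 scaler0.
by rewrite frame_linear tangent_map_linear // IH H scalerDr !scalerA mulrC.
Qed.

(** I, J and K are constant in the frame. *)
Lemma rho_intertwines q r (t : R) i j : 0 <= q -> 0 <= r -> 0 < t ->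
  intertwines (leaf q r) (rho t) (fun a X => sharp i a (flat j a X)).
Proof.
move=> q0 r0 t0 a X La /(leaf_tangentP _ (leaf_Phi La))[c ->].
have Pa := leaf_Phi La; have Pra := leaf_Phi (rho_leaf t0 La).
rewrite sharp_flatE // !tangent_map_rho // sharp_flatE //.
by rewrite -!scalemxAl scalerN.
Qed.

Lemma rho_metric q r (t : R) : 0 <= q -> 0 <= r -> 0 < t ->
  pullback_metric_scaled (leaf q r) (rho t) (Num.sqrt t).
Proof.
move=> q0 r0 t0 a X Y La; have Pa := leaf_Phi La.
move=> /(leaf_tangentP _ Pa)[c ->] /(leaf_tangentP _ Pa)[d ->].
have Pra := leaf_Phi (rho_leaf t0 La).
rewrite !tangent_map_rho // !metricE // Phi_rho -scalemxAl [(_ *: d)^T]linearZ.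
rewrite /= -scalemxAr mxE mxE.
have st0 : Num.sqrt t != 0 by rewrite gt_eqF // sqrtr_gt0.
by field.
Qed.
End leaf_invariants.

Theorem theorem1p1 (R : realType) :
  (forall q r q' r' : R, 0 <= q -> 0 <= r -> 0 <= q' -> 0 <= r' ->
     leaf_type q r <> leaf_type q' r' ->
     ~ hyperkahler_isomorphic (leaf q r) (leaf q' r'))
  /\
  (forall q r t : R, 0 <= q -> 0 <= r -> 0 < t ->
     [/\ diffeomorphism (leaf q r) (leaf (q * t) (r * t)) (rho t),
         intertwines (leaf q r) (rho t) cplxI,
         intertwines (leaf q r) (rho t) cplxJ,
         intertwines (leaf q r) (rho t) cplxK
       & pullback_metric_scaled (leaf q r) (rho t) (Num.sqrt t)]).
Proof.
split=> [q r q' r' q0 r0 q0' r0' ne iso|q r t q0 r0 t0].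
  exact/ne/leaf_type_isomorphic.
split.
- exact: rho_diffeomorphism.
- exact: rho_intertwines.
- exact: rho_intertwines.
- exact: rho_intertwines.
- exact: rho_metric.
Qed.
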